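(* Let $E$ be a reflexive real Banach space whose norm is uniformly Gâteaux differentiable, and suppose that $E$ has the fixed point property for nonexpansive mappings. Let $C$ be a nonempty closed convex subset of $E$, $\{S_n\}_{n\in\mathbb N}$ a sequence of self-mappings of $C$, $T\colon C\to C$ a nonexpansive mapping, $\{\alpha_n\}_{n\in\mathbb N}$ a sequence in $(0,1]$, $u$ a point in $C$, and $\{x_n\}$ the sequence defined by $x_1\in C$ (arbitrary) and $$x_{n+1}=\alpha_n u+(1-\alpha_n)S_nx_n\qquad (n\in\mathbb N).$$ Suppose that $\alpha_n\to 0$, $\sum_{n=1}^\infty\alpha_n=\infty$, $\{S_n\}$ is a strongly nonexpansive sequence, and $\{S_n\}$ satisfies the NST condition (I) with $T$. Then $\{x_n\}$ converges strongly (i.e. in norm) to $Qu$, where $Q$ is the sunny nonexpansive retraction of $C$ onto $\mathrm{F}(T)$.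
   Context: $\mathbb N$ is the set of positive integers. For a mapping $T\colon C\to E$ with $C\subset E$, $\mathrm F(T)=\{x\in C: Tx=x\}$; for a sequence $\{S_n\}$ of mappings $C\to E$, $\mathrm F(\{S_n\})=\bigcap_{n=1}^\infty \mathrm F(S_n)$. $T$ is nonexpansive if $\|Tx-Ty\|\le\|x-y\|$ for all $x,y\in C$. With $U_E=\{x\in E:\|x\|=1\}$, the norm of $E$ is uniformly Gâteaux differentiable if for each $y\in U_E$ the limit $\lim_{t\to0}(\|x+ty\|-\|x\|)/t$ exists for all $x\in U_E$ and is attained uniformly for $x\in U_E$. $E$ has the fixed point property for nonexpansive mappings if every nonexpansive self-mapping of a nonempty bounded closed convex subset $D$ of $E$ has a fixed point in $D$. $\{S_n\}$ (mappings $C\to E$) is a strongly nonexpansive sequence if each $S_n$ is nonexpansive and $x_n-y_n-(S_nx_n-S_ny_n)\to0$ whenever $\{x_n\},\{y_n\}$ are sequences in $C$ such that $\{x_n-y_n\}$ is bounded and $\|x_n-y_n\|-\|S_nx_n-S_ny_n\|\to0$. $\{S_n\}$ satisfies the NST condition (I) with a mapping $T\colon C\to E$ if $\mathrm F(\{S_n\})\neq\emptyset$, $\mathrm F(T)\subset\mathrm F(\{S_n\})$, and $x_n-Tx_n\to0$ whenever $\{x_n\}$ is a bounded sequence in $C$ with $x_n-S_nx_n\to0$. (This forces $\mathrm F(T)=\mathrm F(\{S_n\})$.) For nonempty $K\subset C$, a mapping $Q$ of $C$ onto $K$ is a retraction if $Qx=x$ for all $x\in K$; it is sunny if $Q(Qx+\lambda(x-Qx))=Qx$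 whenever $x\in C$, $\lambda\ge0$ and $Qx+\lambda(x-Qx)\in C$. A sunny nonexpansive retraction is a retraction that is sunny and nonexpansive. It is known that, when $E$ is a reflexive real Banach space whose norm is uniformly Gâteaux differentiable, $E$ has the fixed point property for nonexpansive mappings, and $C$ is a nonempty closed convex subset of $E$, for a nonexpansive self-mapping $T$ of $C$ with $\mathrm F(T)\ne\emptyset$ there is a unique sunny nonexpansive retraction of $C$ onto $\mathrm F(T)$. *)

(* Defs.v *)
From HB Require Import structures.
From mathcomp Require Import all_boot all_order all_algebra.
From mathcomp Require Import all_classical all_reals all_analysis.

Set Implicit Arguments.
Unset Strict Implicit.
Unset Printing Implicit Defensive.

Import Order.TTheory GRing.Theory Num.Theory.
Import numFieldNormedType.Exports.

Local Open Scope classical_set_scope.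
Local Open Scope ring_scope.

(* Conventions. A mapping C -> E is represented by a total function E -> E of  *)
(* which only the values on C matter. Sequences indexed by the positive       *)
(* integers are indexed by nat, the entry 0 standing for the first term.      *)

Section geometry_of_the_space.
Context {R : realType} (E : normedModType R).

Definition dual_space : set (E -> R^o) := [set f | linear f /\ continuous f].

Definition dual_norm (f : E -> R^o) : R :=
  sup [set `|f x| | x in [set x : E | `|x| <= 1]].

(* Elements of E** are functions defined on all of E -> R^o; only their       *)
(* restriction to E* is constrained.                                          *)
Definition bidual_space : set ((E -> R^o) -> R) :=
  [set phi |
    (forall (a : R) (f g : E -> R^o), dual_space f -> dual_space g ->
       phi (a *: f + g) = a * phi f + phi g) /\
    (exists M : R, forall f, dual_space f -> `|phi f| <= M * dual_norm f)].

(* The canonical embedding of E into E** is onto. *)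
Definition reflexive_space : Prop :=
  forall phi, bidual_space phi ->
    exists x : E, forall f, dual_space f -> phi f = f x.

Definition uniformly_gateaux_differentiable_norm : Prop :=
  forall y : E, `|y| = 1 ->
    exists l : E -> R^o,
      {uniform [set x : E | `|x| = 1],
        (fun (t : R) (x : E) => (`|x + t *: y| - `|x|) / t : R^o) @ 0^' --> l}.

Definition nonexpansive (C : set E) (T : E -> E) : Prop := 1.-lipschitz_C T.

Definition fixed_point_property : Prop :=
  forall D : set E, D !=set0 -> bounded_set D -> closed D -> convex_set D ->
    forall T : E -> E, set_fun D D T -> nonexpansive D T ->
      exists2 x, D x & T x = x.

End geometry_of_the_space.

Section mappings.
Context {R : realType} {E : normedModType R}.
Implicit Types (C K : set E) (T Q : E -> E) (S : nat -> E -> E).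

Definition fixed_points C T : set E := [set x | C x /\ T x = x].

Definition common_fixed_points C S : set E :=
  \bigcap_n fixed_points C (S n).

Definition strongly_nonexpansive_sequence C S : Prop :=
  (forall n, nonexpansive C (S n)) /\
  (forall x y : nat -> E, (forall n, C (x n)) -> (forall n, C (y n)) ->
     bounded_fun (fun n => x n - y n) ->
     `|x n - y n| - `|S n (x n) - S n (y n)| @[n --> \oo] --> (0 : R) ->
     x n - y n - (S n (x n) - S n (y n)) @[n --> \oo] --> (0 : E)).

Definition NST_condition_I C S T : Prop :=
  [/\ common_fixed_points C S !=set0,
      fixed_points C T `<=` common_fixed_points C S &
      forall x : nat -> E, (forall n, C (x n)) -> bounded_fun x ->
        x n - S n (x n) @[n --> \oo] --> (0 : E) ->
        x n - T (x n) @[n --> \oo] --> (0 : E)].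

Definition retraction C K Q : Prop :=
  [/\ set_fun C K Q, set_surj C K Q & forall x, K x -> Q x = x].

Definition sunny C Q : Prop :=
  forall (x : E) (lambda : R), C x -> 0 <= lambda ->
    C (Q x + lambda *: (x - Q x)) ->
    Q (Q x + lambda *: (x - Q x)) = Q x.

Definition sunny_nonexpansive_retraction C K Q : Prop :=
  [/\ retraction C K Q, sunny C Q & nonexpansive C Q].

End mappings.

(* Main.v *)
(** Let [J x y] be the derivative of [|.|^2 / 2] at [x] in the direction [y]; as
    the norm is uniformly Gateaux differentiable, [J] is uniformly continuous in
    [x] on bounded sets. The points [z = t u + (1 - t) T z], [t = 1 / (n + 1)],
    have an asymptotic center along an ultrafilter: by reflexivity the function
    [y |-> lim |z_n - y|] attains its minimum on [C], its minimizers form a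
    [T]-invariant bounded closed convex set, and the fixed point property yields
    a minimizer [p] fixed by [T]. Comparing [p] with [p + s (u - p)] gives
    [z_n --> p] along the ultrafilter, hence [J (w - p) (u - p)] is almost
    nonpositive at every almost fixed point [w] of [T] in a bounded set. At fixed
    points this is the variational inequality that characterizes the value at [u]
    of the sunny nonexpansive retraction.

    For the iteration put [a_n = |x_n - p|^2] and fix [e > 0]. If
    [|x_n - p| - |S_n x_n - p|] is small, then strong nonexpansiveness and the NST
    condition make [x_{n+1}] an almost fixed point of [T], so that
    [J (x_{n+1} - p) (u - p) <= e]; otherwise [|S_n x_n - p|^2] lies below [a_n]
    by a fixed amount, which absorbs the terms of order [alpha_n]. In both cases
    [a_{n+1} <= (1 - alpha_n) a_n + 2 alpha_n e] for large [n]. *)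

Require Import Defs.
From HB Require Import structures.
From mathcomp Require Import all_boot all_order all_algebra.
From mathcomp Require Import all_classical all_reals all_analysis.
From mathcomp Require Import ring lra.

Set Implicit Arguments.
Unset Strict Implicit.
Unset Printing Implicit Defensive.

Import Order.TTheory GRing.Theory Num.Theory.
Import numFieldNormedType.Exports.

Local Open Scope classical_set_scope.
Local Open Scope ring_scope.

(** * Hahn-Banach and weak lower semicontinuity *)

Section hahn_banach.
Context {R : realType} (E : lmodType R).
Implicit Types (p q : E -> R) (x y v : E).

Definition sublinear p : Prop :=
  (forall x y, p (x + y) <= p x + p y) /\
  (forall (t : R) x, 0 < t -> p (t *: x) = t * p x).

Lemma sublinear0 p : sublinear p -> p 0 = 0.
Proof.
by move=> [_ pZ]; have := pZ 2 0 (ltr0Sn _ _); rewrite scaler0; lra.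
Qed.

Lemma sublinear_geN p x : sublinear p -> - p (- x) <= p x.
Proof.
move=> sp; have := sp.1 x (- x).
by rewrite subrr sublinear0//; lra.
Qed.

Lemma has_inf_lb (A : set R) (a b : R) : A a -> lbound A b -> has_inf A.
Proof. by move=> Aa Ab; split; [exists a | exists b]. Qed.

Lemma inf_lb_le (A : set R) (a b : R) : A a -> lbound A b -> inf A <= a.
Proof. by move=> Aa Ab; apply: ge_inf => //; exists b. Qed.

Lemma inf_lb_lt_ex (A : set R) (a b e : R) : A a -> lbound A b -> 0 < e ->
  exists2 c, A c & c < inf A + e.
Proof. by move=> Aa Ab e0; apply: inf_adherent => //; apply: has_inf_lb Aa Ab. Qed.

(** The bound [- p (- x)] keeps the pointwise infimum finite. Of two members nearly optimal at [x]
    and at [y], the smaller one is nearly optimal at both points, whence subadditivity. *)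
Lemma sublinear_chain_inf p (A : set (E -> R)) :
  A !=set0 -> (forall q, A q -> sublinear q /\ forall x, q x <= p x) ->
  (forall q r, A q -> A r -> (forall x, q x <= r x) \/ (forall x, r x <= q x)) ->
  sublinear (fun x => inf [set q x | q in A]).
Proof.
move=> [q0 Aq0] Ap Atot.
have lb x : lbound [set q x | q in A] (- p (- x)).
  move=> _ [q Aq <-]; have [sq qp] := Ap q Aq.
  by apply: le_trans (sublinear_geN x sq); rewrite lerN2 qp.
have img q x : A q -> [set q x | q in A] (q x) by move=> Aq; exists q.
split=> [x y|t x t0].
  apply/ler_addgt0Pr => e e0; have e20 : 0 < e / 2 by lra.
  have [_ [q Aq <-] hq] := inf_lb_lt_ex (img _ x Aq0) (@lb x) e20.
  have [_ [r Ar <-] hr] := inf_lb_lt_ex (img _ y Aq0) (@lb y) e20.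
  have [qr|rq] := Atot q r Aq Ar.
    have := inf_lb_le (img q (x + y) Aq) (@lb _).
    have := (Ap q Aq).1.1 x y; have := qr y; lra.
  have := inf_lb_le (img r (x + y) Ar) (@lb _).
  have := (Ap r Ar).1.1 x y; have := rq x; lra.
apply/eqP; rewrite eq_le; apply/andP; split.
  rewrite -ler_pdivrMl//; apply: lb_le_inf; first by exists (q0 x); exact: img.
  move=> _ [q Aq <-]; rewrite ler_pdivrMl// -((Ap q Aq).1.2 _ _ t0).
  exact: inf_lb_le (img _ _ Aq) (@lb _).
apply: lb_le_inf; first by exists (q0 (t *: x)); exact: img.
move=> _ [q Aq <-]; rewrite ((Ap q Aq).1.2 _ _ t0) ler_pM2l//.
exact: inf_lb_le (img _ _ Aq) (@lb _).
Qed.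

(** Since [t = 0] and [t = 1] are both allowed, the result lies below [q] and below
    [q (x + y) - q y]; equality with [q] thus forces superadditivity. *)
Let shift_fun q y x :=
  inf [set q (x + t *: y) - t * q y | t in [set t : R | 0 <= t]].

Lemma sublinear_shift q y : sublinear q ->
  [/\ sublinear (shift_fun q y), forall x, shift_fun q y x <= q x &
      forall x, shift_fun q y x <= q (x + y) - q y].
Proof.
move=> sq; have q0 := sublinear0 sq.
have qZ t x : 0 <= t -> q (t *: x) = t * q x.
  rewrite le_eqVlt => /orP[/eqP <-|]; first by rewrite scale0r mul0r.
  exact: sq.2.
have lb x : lbound [set q (x + t *: y) - t * q y | t in [set t : R | 0 <= t]]
    (- q (- x)).
  move=> _ [t /= t0 <-]; rewrite -qZ//.
  by have := sq.1 (x + t *: y) (- x); rewrite addrAC subrr add0r; lra.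
have img t x : 0 <= t ->
    [set q (x + t *: y) - t * q y | t in [set t : R | 0 <= t]]
      (q (x + t *: y) - t * q y) by move=> t0; exists t.
have le0 x t : 0 <= t -> shift_fun q y x <= q (x + t *: y) - t * q y.
  by move=> t0; apply: inf_lb_le (img _ _ t0) (@lb _).
split; last 2 first.
- by move=> x; have := le0 x 0 (lexx _); rewrite scale0r addr0 mul0r subr0.
- by move=> x; have := le0 x 1 ler01; rewrite scale1r mul1r.
split=> [x z|s x s0].
  apply/ler_addgt0Pr => e e0; have e20 : 0 < e / 2 by lra.
  have [_ [t /= t0 <-] ht] := inf_lb_lt_ex (img _ x (lexx 0)) (@lb x) e20.
  have [_ [r /= r0 <-] hr] := inf_lb_lt_ex (img _ z (lexx 0)) (@lb z) e20.
  have := le0 (x + z) (t + r) (addr_ge0 t0 r0).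
  have := sq.1 (x + t *: y) (z + r *: y).
  by rewrite addrACA -scalerDl mulrDl; rewrite -/(shift_fun _ _ _) in ht hr; lra.
apply/eqP; rewrite eq_le; apply/andP; split.
  rewrite -ler_pdivrMl//; apply: lb_le_inf.
    by exists (q (x + 0 *: y) - 0 * q y); exact: img.
  move=> _ [t /= t0 <-]; rewrite ler_pdivrMl//.
  have := le0 (s *: x) (s * t) (mulr_ge0 (ltW s0) t0).
  by rewrite -scalerA -scalerDr sq.2// -mulrA mulrBr.
apply: lb_le_inf; first by exists (q (s *: x + 0 *: y) - 0 * q y); exact: img.
move=> _ [t /= t0 <-]; rewrite -ler_pdivlMl//.
have s1 : 0 <= s^-1 by rewrite invr_ge0 ltW.
apply: le_trans (le0 x (s^-1 * t) (mulr_ge0 s1 t0)) _.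
have -> : x + (s^-1 * t) *: y = s^-1 *: (s *: x + t *: y).
  by rewrite scalerDr !scalerA mulVf ?scale1r// gt_eqF.
by rewrite qZ// -mulrA mulrBr.
Qed.

(* Hahn-Banach without extending functionals: a minimal sublinear functional  *)
(* below [p] is linear, since otherwise [shift_fun] would produce a smaller   *)
(* one.                                                                       *)
Lemma sublinear_minorant p : sublinear p ->
  exists f : E -> R^o, linear f /\ forall x, f x <= p x.
Proof.
move=> sp; pose P q := sublinear q /\ forall x, q x <= p x.
pose T := {q : E -> R | P q}.
pose p0 : T := exist P p (conj sp (fun x => lexx (p x))).
(* The order is reversed: a maximal element for [le_T] is a minimal functional. *)
pose le_T (q r : T) := `[< forall x, sval r x <= sval q x >].
have [[q [sq qp]] qmin] : exists t, forall s, le_T t s -> s = t.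
  apply: Zorn.
  - by move=> q; apply/asboolP => x.
  - move=> q r s /asboolP qr /asboolP rs; apply/asboolP => x.
    exact: le_trans (rs x) (qr x).
  - move=> [q hq] [r hr] /asboolP /= qr /asboolP /= rq; apply: eq_exist.
    by apply/funext => x; apply/eqP; rewrite eq_le qr rq.
  - move=> A Atot; have [[a0 Aa0]|A0] := pselect (A !=set0); last first.
      by exists p0 => s As; case: A0; exists s.
    pose B := [set sval a | a in A].
    have B0 : B !=set0 by exists (sval a0), a0.
    have Bp q : B q -> sublinear q /\ forall x, q x <= p x.
      by move=> [a _ <-]; exact: (svalP a).
    have Binf : forall q, B q -> forall x, inf [set r x | r in B] <= q x.
      move=> q Bq x; apply: (@inf_lb_le _ _ (- p (- x))); first by exists q.
      move=> _ [r Br <-]; apply: le_trans (sublinear_geN x (Bp r Br).1).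
      by rewrite lerN2 (Bp r Br).2.
    have sB : sublinear (fun x => inf [set r x | r in B]).
      apply: (sublinear_chain_inf B0 Bp) => _ _ [a Aa <-] [b Ab <-].
      by have [/asboolP ?|/asboolP ?] := Atot a b Aa Ab; [right|left].
    have leB x : inf [set r x | r in B] <= p x.
      by have [q Bq] := B0; apply: le_trans (Binf q Bq x) ((Bp q Bq).2 x).
    exists (exist P _ (conj sB leB)) => s As; apply/asboolP => x /=.
    by apply: Binf; exists s.
(* Minimality of [q], applied to its shift, gives the converse of subadditivity. *)
have qle y x : q x <= q (x + y) - q y.
  have [ss s1 s2] := sublinear_shift y sq.
  have sp' x' : shift_fun q y x' <= p x' by apply: le_trans (s1 x') (qp x').
  have /= := qmin (exist P _ (conj ss sp')).
  move=> /(_ (introT (asboolP _) s1)) [] /(congr1 (fun f => f x)) <-.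
  exact: s2.
have qD x y : q (x + y) = q x + q y.
  by apply/eqP; rewrite eq_le sq.1 /=; have := qle y x; lra.
have qN x : q (- x) = - q x.
  by have := qD x (- x); rewrite subrr sublinear0//; lra.
exists q; split=> // a x y /=; rewrite qD; congr (_ + _).
have [a0|a0|->] := ltgtP a 0.
- rewrite -[a *: x]opprK -scaleNr qN sq.2 ?oppr_gt0// mulNr opprK.
  by [].
- exact: sq.2.
- by rewrite !scale0r (sublinear0 sq).
Qed.

End hahn_banach.

(** * Subgradients of convex functionals with Lipschitz constant 1 *)

Section subgradient.
Context {R : realType} {E : normedModType R}.
Implicit Types (phi : E -> R) (x y v : E).

Definition convex_functional phi : Prop := forall x y (t : R), 0 <= t <= 1 ->
  phi (t *: x + (1 - t) *: y) <= t * phi x + (1 - t) * phi y.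

Definition shortmap phi : Prop := forall x y, phi x <= phi y + `|x - y|.

Let quot phi x v (t : R) := (phi (x + t *: v) - phi x) / t.

(** For convex [phi] the quotients are nondecreasing in [t], so this infimum is the one-sided
    derivative, obtained without a limit. *)
Let directional_derivative phi x v :=
  inf [set quot phi x v t | t in [set t : R | 0 < t]].

Lemma quot_ge phi x v (t : R) : shortmap phi -> 0 < t -> - `|v| <= quot phi x v t.
Proof.
move=> sphi t0; rewrite /quot ler_pdivlMr//.
have := sphi x (x + t *: v).
rewrite opprD addrA subrr add0r normrN normrZ gtr0_norm//; lra.
Qed.

Lemma directional_derivative_le phi x v (t : R) : shortmap phi -> 0 < t ->
  directional_derivative phi x v <= quot phi x v t.
Proof.
move=> sphi t0; apply: (@inf_lb_le _ _ _ (- `|v|)); first by exists t.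
by move=> _ [s /= s0 <-]; exact: quot_ge.
Qed.

Lemma sublinear_directional_derivative phi x :
  convex_functional phi -> shortmap phi -> sublinear (directional_derivative phi x).
Proof.
move=> cphi sphi.
have lb v : lbound [set quot phi x v t | t in [set t : R | 0 < t]] (- `|v|).
  by move=> _ [s /= s0 <-]; exact: quot_ge.
have img v (t : R) : 0 < t ->
  [set quot phi x v t | t in [set t : R | 0 < t]] (quot phi x v t).
  by move=> t0; exists t.
split=> [v w|s v s0].
  apply/ler_addgt0Pr => e e0; have e20 : 0 < e / 2 by lra.
  have [_ [a /= a0 <-] ha] := inf_lb_lt_ex (img v _ ltr01) (@lb v) e20.
  have [_ [b /= b0 <-] hb] := inf_lb_lt_ex (img w _ ltr01) (@lb w) e20.
  rewrite -!/(directional_derivative _ _ _) in ha hb.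
  have ab0 : 0 < a + b by rewrite addr_gt0.
  have anz : a != 0 by rewrite gt_eqF.
  have bnz : b != 0 by rewrite gt_eqF.
  have abnz : a + b != 0 by rewrite gt_eqF.
  (* With this [t], the point [x + t *: (v + w)] is the convex combination of [x + a *: v] and
     [x + b *: w] with weights [b / (a + b)] and [a / (a + b)]; dividing by [t] turns these weights
     into [1 / a] and [1 / b]. *)
  pose t := a * b / (a + b).
  have t0 : 0 < t by rewrite divr_gt0 ?mulr_gt0.
  have := directional_derivative_le x (v + w) sphi t0.
  suff : quot phi x (v + w) t <= quot phi x v a + quot phi x w b by lra.
  rewrite /quot ler_pdivrMr//.
  have s01 : 0 <= b / (a + b) <= 1.
    by rewrite divr_ge0 ?(ltW b0) ?(ltW ab0)//= ler_pdivrMr// mul1r lerDr ltW.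
  have := cphi (x + a *: v) (x + b *: w) _ s01.
  have -> : (b / (a + b)) *: (x + a *: v) + (1 - b / (a + b)) *: (x + b *: w) =
            x + t *: (v + w).
    rewrite [X in X + _]scalerDr [X in _ + X]scalerDr !scalerA addrACA -scalerDl.
    rewrite [X in X *: x + _]addrC subrK scale1r [in RHS]scalerDr.
    by rewrite /t; congr (_ + (_ *: _ + _ *: _)); field.
  move=> h; rewrite lerBlDr; apply: le_trans h _.
  rewrite le_eqVlt; apply/orP; left; apply/eqP; rewrite /t.
  by field; rewrite anz bnz abnz.
apply/eqP; rewrite eq_le; apply/andP; split.
  rewrite -ler_pdivrMl//; apply: lb_le_inf.
    by exists (quot phi x v 1); exact: img.
  move=> _ [t /= t0 <-]; rewrite ler_pdivrMl//.
  have := directional_derivative_le x (s *: v) sphi (divr_gt0 t0 s0).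
  rewrite /quot scalerA divfK ?gt_eqF// invf_div.
  by rewrite mulrCA.
apply: lb_le_inf; first by exists (quot phi x (s *: v) 1); exact: img.
move=> _ [t /= t0 <-]; rewrite -ler_pdivlMl//.
apply: le_trans (directional_derivative_le x v sphi (mulr_gt0 t0 s0)) _.
by rewrite /quot scalerA invfM mulrA [leRHS]mulrC.
Qed.

Lemma linear_of_sub (f : E -> R^o) : linear f -> forall x y, f (x - y) = f x - f y.
Proof. by move=> lf x y; rewrite addrC -scaleN1r lf scaleN1r addrC. Qed.

Lemma linear_of0 (f : E -> R^o) : linear f -> f 0 = 0.
Proof. by move=> lf; rewrite -[X in f X](subrr 0) linear_of_sub// subrr. Qed.

Lemma linear_ofZ (f : E -> R^o) : linear f -> forall a x, f (a *: x) = a * f x.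
Proof. by move=> lf a x; rewrite -[a *: x]addr0 lf linear_of0// addr0. Qed.

Lemma linear_le_norm_dual (f : E -> R^o) (k : R) : linear f ->
  (forall x, f x <= k * `|x|) -> dual_space f.
Proof.
move=> lf fk; split=> // x; apply/cvgrPdist_le => e e0.
have fN z : `|f z| <= k * `|z|.
  rewrite ler_norml fk andbT -(normrN z) lerNl.
  by rewrite -[leLHS]add0r -{1}(linear_of0 lf) -linear_of_sub// sub0r.
have k0 : 0 < `|k| + 1 by rewrite ltr_wpDl.
near=> z; rewrite -linear_of_sub//; apply: le_trans (fN _) _.
apply: le_trans (_ : _ <= (`|k| + 1) * `|x - z|) _.
  by rewrite ler_wpM2r// (le_trans (ler_norm k))// lerDl.
rewrite -ler_pdivlMl// mulrC; near: z.
by apply: cvgr_dist_le => //; rewrite divr_gt0.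
Unshelve. all: by end_near. Qed.

(** A linear minorant of the directional derivative at [x] works; the Lipschitz bound makes it
    continuous. *)
Lemma subgradient phi x : convex_functional phi -> shortmap phi ->
  exists2 f : E -> R^o, dual_space f & forall y, phi x + f (y - x) <= phi y.
Proof.
move=> cphi sphi.
have [f [lf fp]] := sublinear_minorant (sublinear_directional_derivative x cphi sphi).
have fq v : f v <= phi (x + v) - phi x.
  apply: le_trans (fp v) _.
  by have := directional_derivative_le x v sphi ltr01; rewrite /quot scale1r divr1.
exists f; last by move=> y; have := fq (y - x); rewrite addrCA subrr addr0; lra.
apply: (@linear_le_norm_dual _ 1) => // v; apply: le_trans (fq v) _.
by have := sphi (x + v) x; rewrite addrAC subrr add0r mul1r; lra.
Qed.

End subgradient.

(** * Weak limits along ultrafilters *)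

Section weak_limits.
Context {R : realType} {E : normedModType R}.

(** The image of an ultrafilter is an ultrafilter, and it contains the compact segment from [- M] to
    [M]. *)
Lemma ultra_bounded_cvg {T : Type} (U : set_system T) (a : T -> R) (M : R) :
  UltraFilter U -> (forall i, `|a i| <= M) -> cvg (a i @[i --> U]).
Proof.
move=> UU aM.
have aU : UltraFilter (a @ U).
  split; first exact: fmap_proper_filter.
  move=> G GF aUG; rewrite predeqE => A; split; last exact: aUG.
  move=> GA; have [//|nA] := in_ultra_setVsetC (a @^-1` A) UU.
  have GnA : G (~` A) by apply: aUG.
  by have [? []] := filter_ex (filterI GA GnA).
have cI := @segment_compact R (- M) M; rewrite compact_ultra in cI.
have aI : (a @ U) [set` `[- M, M]].
  apply: (@filterE _ U) => i /=; rewrite in_itv /= -ler_norml; exact: aM.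
have [l [_ al]] := cI _ aU aI.
by apply/cvg_ex; exists l.
Qed.

(** The supremum bounds its set only once that set is known to be bounded above; continuity of [f]
    provides this. *)
Lemma dual_norm_ub (f : E -> R^o) (x : E) : dual_space f -> `|x| <= 1 ->
  `|f x| <= dual_norm f.
Proof.
move=> [lf cf] x1; apply: ub_le_sup; last by exists x.
pose F : {linear E -> R^o} := HB.pack f (GRing.isLinear.Build _ _ _ _ f lf).
have /linear_boundedP/pinfty_ex_gt0[M M0 fM] : bounded_near F (nbhs 0).
  exact/linear_bounded_continuous.
exists M => _ [z /= z1 <-]; apply: le_trans (fM z) _.
by rewrite ler_piMr// ltW.
Qed.

Lemma dual_norm_bound (f : E -> R^o) (x : E) : dual_space f ->
  `|f x| <= dual_norm f * `|x|.
Proof.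
move=> df; have [lf _] := df.
have [->|x0] := eqVneq x 0; first by rewrite linear_of0// !normr0 mulr0.
have nx : 0 < `|x| by rewrite normr_gt0.
rewrite -ler_pdivrMr//.
have := @dual_norm_ub f (`|x|^-1 *: x) df.
rewrite normrZ linear_ofZ// normrM gtr0_norm ?invr_gt0// mulVf ?gt_eqF//.
by rewrite mulrC; apply.
Qed.

(** Along an ultrafilter all the limits of [f (y n)] exist at once and depend linearly on [f], with
    bound [M]; reflexivity represents this element of the bidual by a point, so no subsequence is
    extracted. *)
Lemma reflexive_weak_limit (U : set_system nat) (y : nat -> E) (M : R) :
  reflexive_space E -> UltraFilter U -> (forall n, `|y n| <= M) ->
  exists x : E, forall f : E -> R^o, dual_space f -> f (y n) @[n --> U] --> f x.
Proof.
move=> rE UU yM.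
have PU : ProperFilter U := ultra_proper.
have M0 : 0 <= M by apply: le_trans (yM 0%N).
have fy f : dual_space f -> forall n, `|f (y n)| <= M * dual_norm f.
  move=> df n; have d0 : 0 <= dual_norm f.
    by apply: le_trans (normr_ge0 (f 0)) _; apply: dual_norm_ub; rewrite ?normr0.
  by apply: le_trans (dual_norm_bound _ df) _; rewrite mulrC ler_wpM2r.
have cfy f : dual_space f -> cvg ((f (y n) : R) @[n --> U]).
  by move=> df; apply: ultra_bounded_cvg UU (fy f df).
have [|x xf] := rE (fun f => lim ((f (y n) : R) @[n --> U])).
  split.
    move=> a f g df dg; apply/cvg_lim => //.
    apply: cvgD; last exact: cfy.
    by apply: cvgM; [exact: cvg_cst | exact: cfy].
  exists M => f df; rewrite ler_norml; apply/andP; split.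
    apply: limr_ge; first exact: cfy.
    by apply: nearW => n; have := fy f df n; rewrite ler_norml => /andP[].
  apply: limr_le; first exact: cfy.
  by apply: nearW => n; have := fy f df n; rewrite ler_norml => /andP[].
exists x => f df; have <- := xf f df. exact: cfy.
Qed.

(** A subgradient [f] at [x] gives [phi x + f (y n - x) <= phi (y n)], and the term in [f] tends to
    0. *)
Lemma convex_weak_lsc (U : set_system nat) (y : nat -> E) (x : E) (phi : E -> R)
  (m : R) : ProperFilter U ->
  (forall f : E -> R^o, dual_space f -> f (y n) @[n --> U] --> f x) ->
  convex_functional phi -> shortmap phi ->
  phi (y n) @[n --> U] --> m -> phi x <= m.
Proof.
move=> PU yx cphi sphi phim.
have [f df hf] := subgradient x cphi sphi.
have fyx : f (y n) - f x @[n --> U] --> (0 : R).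
  by rewrite -(subrr (f x)); apply: cvgB; [exact: yx | exact: cvg_cst].
have : phi x + (f (y n) - f x) @[n --> U] --> phi x + 0.
  by apply: cvgD => //; exact: cvg_cst.
rewrite addr0 => phix; apply: (ler_cvg_to phix phim).
by apply: nearW => n; rewrite -linear_of_sub//; exact: df.1.
Qed.

End weak_limits.

(** * The duality map *)

Section duality_map.
Context {R : realType} {E : normedModType R}.
Implicit Types (x y z : E) (M e t : R).

Lemma gateaux_unit_sphere y : uniformly_gateaux_differentiable_norm E -> `|y| = 1 ->
  exists l : E -> R, forall e, 0 < e -> exists2 d : R, 0 < d &
    forall x t, `|x| = 1 -> `|t| < d -> `| `|x + t *: y| - 1 - t * l x| <= e * `|t|.
Proof.
move=> gE y1; have [l hl] := gE y y1; exists l => e e0.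
have := hl [set g | forall x : E, `|x| = 1 -> ball (l x : R^o) e (g x)].
case.
  apply/uniform_nbhs; exists [set xy : R^o * R^o | ball xy.1 e xy.2].
  by split=> //; exact: entourage_ball (PosNum e0).
move=> d /= d0 hd; exists d => // x t x1 td.
have [->|t0] := eqVneq t 0;
  first by rewrite scale0r addr0 x1 subrr mul0r subrr !normr0 mulr0.
have : ball (l x : R^o) e ((`|x + t *: y| - `|x|) / t).
  by apply: hd => //=; rewrite sub0r normrN.
rewrite -ball_normE /= x1 distrC => /ltW h.
have -> : `|x + t *: y| - 1 - t * l x = ((`|x + t *: y| - 1) / t - l x) * t.
  by field.
by rewrite normrM ler_wpM2r.
Qed.

(** The derivative on the sphere is carried to other points by homogeneity. This degenerates near
    the origin, where the factor [|x|] of the squared norm makes the error small anyway. *)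
Lemma sqnorm_gateaux_unit y : uniformly_gateaux_differentiable_norm E -> `|y| = 1 ->
  exists j : E -> R, forall M e, 0 < e -> exists2 d : R, 0 < d &
    forall x t, `|x| <= M -> `|t| <= d ->
      `| `|x + t *: y| ^+ 2 - `|x| ^+ 2 - 2 * t * j x| <= e * `|t|.
Proof.
move=> gE y1; have [l hl] := gateaux_unit_sphere gE y1.
have l1 x : `|x| = 1 -> `|l x| <= 1.
  move=> x1; apply/ler_addgt0Pr => e e0; have [d d0 hd] := hl e e0.
  have d20 : 0 < d / 2 by rewrite divr_gt0.
  have d2d : `|d / 2| < d by rewrite gtr0_norm//; lra.
  have := hd x (d / 2) x1 d2d; rewrite (gtr0_norm d20).
  have := ler_normD (x + (d / 2) *: y) (- (d / 2 *: y)).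
  have := ler_normD x (d / 2 *: y).
  rewrite addrK normrN normrZ y1 x1 gtr0_norm// => h1 h2 h3.
  have : `|d / 2 * l x| <= d / 2 * (1 + e).
    have := ler_normB (`|x + (d / 2) *: y| - 1) (`|x + (d / 2) *: y| - 1 - d / 2 * l x).
    rewrite opprB addrC subrK => h4.
    have : `| `|x + (d / 2) *: y| - 1| <= d / 2 by rewrite ler_norml; lra.
    lra.
  by rewrite normrM gtr0_norm// ler_pM2l.
exists (fun x => `|x| * l (`|x|^-1 *: x)) => M e e0.
(* Below radius [r] crude bounds suffice. Above it, [d * r / 2] keeps [t / |x|] under [d], and [e1]
   absorbs the factor [2 * |x|], at most [2 * (|M| + 1)]. The entry [e / 2] of [d1] controls the
   quadratic remainder. *)
pose r := e / 16; have r0 : 0 < r by rewrite /r; lra.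
pose e1 := e / (4 * (`|M| + 1)).
have M10 : 0 < `|M| + 1 by rewrite ltr_wpDl.
have e10 : 0 < e1 by rewrite divr_gt0// mulr_gt0.
have [d d0 hd] := hl e1 e10.
pose d1 := Num.min (e / 2) (d * r / 2).
have d10 : 0 < d1 by rewrite lt_min; apply/andP; split; [lra | rewrite divr_gt0 ?mulr_gt0].
exists d1 => // x t xM; rewrite le_min => /andP[te td].
pose L := l (`|x|^-1 *: x); pose b := `|x + t *: y|.
have b1 : `|b - `|x| | <= `|t|.
  have := ler_dist_dist (x + t *: y) x.
  by rewrite addrAC subrr add0r normrZ y1 mulr1.
suff h : 2 * `|x| * `|b - `|x| - t * L| <= e / 2 * `|t|.
  have -> : b ^+ 2 - `|x| ^+ 2 - 2 * t * (`|x| * L) =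
            2 * `|x| * (b - `|x| - t * L) + (b - `|x|) ^+ 2 by ring.
  apply: le_trans (ler_normD _ _) _; rewrite normrM normrX ger0_norm ?mulr_ge0//.
  have : `|b - `|x| | ^+ 2 <= e / 2 * `|t|.
    by rewrite expr2; apply: ler_pM => //; apply: le_trans b1 te.
  lra.
(* At the origin [L] is a junk value, cancelled by the factor [|x|]. *)
have [->|xn0] := eqVneq x 0.
  by rewrite normr0 mulr0 mul0r mulr_ge0// divr_ge0// ltW.
have x0 : 0 < `|x| by rewrite normr_gt0.
have xn1 : `|(`|x|^-1 *: x)| = 1.
  by rewrite normrZ gtr0_norm ?invr_gt0// mulVf ?gt_eqF.
have [xr|rx] := ltP `|x| r.
  have h1 : `|b - `|x| - t * L| <= 2 * `|t|.
    apply: le_trans (ler_normB _ _) _; rewrite normrM.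
    have : `|t| * `|L| <= `|t| by rewrite ler_piMr// l1.
    lra.
  have : 2 * `|x| * `|b - `|x| - t * L| <= 2 * r * (2 * `|t|).
    by apply: ler_pM => //; rewrite ?mulr_ge0// ler_pM2l// ltW.
  have : 0 <= e * `|t| by rewrite mulr_ge0// ltW.
  by rewrite /r; lra.
have td' : `|t / `|x| | < d.
  rewrite normrM normfV normr_id ltr_pdivrMr//; apply: le_lt_trans td _.
  have : d * r <= d * `|x| by rewrite ler_pM2l.
  have : 0 < d * r by rewrite mulr_gt0.
  lra.
have := hd _ _ xn1 td'.
have -> : `|x|^-1 *: x + (t / `|x|) *: y = `|x|^-1 *: (x + t *: y).
  by rewrite scalerDr scalerA mulrC.
rewrite [in X in X - 1]normrZ (@gtr0_norm _ `|x|^-1) ?invr_gt0// -/b -/L.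
have -> : `|x|^-1 * b - 1 - t / `|x| * L = (b - `|x| - t * L) / `|x|.
  by field; rewrite gt_eqF.
rewrite !normrM !normfV !normr_id ler_pdivrMr// -[leRHS]mulrA divfK ?gt_eqF// => h.
have h2 : 2 * `|x| <= 2 * (`|M| + 1).
  by have := ler_norm M; lra.
apply: le_trans (_ : _ <= 2 * (`|M| + 1) * (e1 * `|t|)) _.
  by apply: ler_pM => //; rewrite mulr_ge0.
rewrite mulrA ler_wpM2r// /e1 le_eqVlt; apply/orP; left; apply/eqP.
by field; rewrite gt_eqF.
Qed.

End duality_map.

Section duality_map_theory.
Context {R : realType} {E : normedModType R}.
Implicit Types (x y z : E) (M e t : R) (J : E -> E -> R).

(* [J x y] is the value at [y] of the derivative of [|.|^2 / 2] at [x], the   *)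
(* derivative being uniform in [x] on bounded sets.                           *)
Definition duality_map J : Prop := forall y M e, 0 < e -> exists2 d : R, 0 < d &
  forall x t, `|x| <= M -> `|t| <= d ->
    `| `|x + t *: y| ^+ 2 - `|x| ^+ 2 - 2 * t * J x y| <= e * `|t|.

Lemma duality_map_exists :
  uniformly_gateaux_differentiable_norm E -> exists J, duality_map J.
Proof.
move=> gE.
suff /choice[j jP] : forall y, exists j : E -> R, forall M e, 0 < e ->
    exists2 d : R, 0 < d & forall x t, `|x| <= M -> `|t| <= d ->
      `| `|x + t *: y| ^+ 2 - `|x| ^+ 2 - 2 * t * j x| <= e * `|t|.
  by exists (fun x y => j y x).
move=> y; have [->|y0] := eqVneq y 0.
  exists (fun=> 0) => M e e0; exists 1 => // x t _ _.
  by rewrite scaler0 addr0 mulr0 subrr subr0 normr0 mulr_ge0// ltW.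
have ny : 0 < `|y| by rewrite normr_gt0.
have [|j jP] := @sqnorm_gateaux_unit _ _ (`|y|^-1 *: y) gE.
  by rewrite normrZ gtr0_norm ?invr_gt0// mulVf ?gt_eqF.
exists (fun x => `|y| * j x) => M e e0.
have [d d0 hd] := jP M (e / `|y|) (divr_gt0 e0 ny).
exists (d / `|y|); first exact: divr_gt0.
move=> x t xM td; have := hd x (t * `|y|) xM.
rewrite normrM normr_id -ler_pdivlMr// => /(_ td).
rewrite scalerA -[t * `|y| / `|y|]mulrA mulfV ?gt_eqF// mulr1.
by rewrite -!mulrA [`|y|^-1 * _]mulrC -[`|t| * _ * _]mulrA mulfV ?gt_eqF// mulr1.
Qed.

Variable J : E -> E -> R.
Hypothesis JP : duality_map J.

(** This lemma and the next reduce estimates of [J] to difference quotients with [t > 0] only. *)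
Lemma duality_le_quotient x y a :
  (forall e, 0 < e -> exists2 d : R, 0 < d & forall t, 0 < t -> t <= d ->
     `|x + t *: y| ^+ 2 - `|x| ^+ 2 <= t * (2 * a + e)) -> J x y <= a.
Proof.
move=> h; apply/ler_addgt0Pr => e e0.
have [d d0 hd] := h e e0.
have [d' d'0 hd'] := JP y `|x| e0.
pose t := Num.min d d'; have t0 : 0 < t by rewrite lt_min d0.
have td : t <= d by rewrite ge_min lexx.
have td' : `|t| <= d' by rewrite gtr0_norm// ge_min lexx orbT.
have := hd' x t (lexx _) td'; rewrite ler_norml => /andP[h1 _].
have := hd t t0 td => h2; rewrite (gtr0_norm t0) in h1.
rewrite -(ler_pM2l t0); lra.
Qed.

Lemma duality_ge_quotient x y a :
  (forall e, 0 < e -> exists2 d : R, 0 < d & forall t, 0 < t -> t <= d ->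
     t * (2 * a - e) <= `|x + t *: y| ^+ 2 - `|x| ^+ 2) -> a <= J x y.
Proof.
move=> h; apply/ler_addgt0Pr => e e0.
have [d d0 hd] := h e e0.
have [d' d'0 hd'] := JP y `|x| e0.
pose t := Num.min d d'; have t0 : 0 < t by rewrite lt_min d0.
have td : t <= d by rewrite ge_min lexx.
have td' : `|t| <= d' by rewrite gtr0_norm// ge_min lexx orbT.
have := hd' x t (lexx _) td'; rewrite ler_norml => /andP[_ h1].
have := hd t t0 td => h2; rewrite (gtr0_norm t0) in h1.
rewrite -(ler_pM2l t0); lra.
Qed.

Lemma sqnorm_convex x y t : 0 <= t <= 1 ->
  `|t *: x + (1 - t) *: y| ^+ 2 <= t * `|x| ^+ 2 + (1 - t) * `|y| ^+ 2.
Proof.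
move=> /andP[t0 t1].
have h : `|t *: x + (1 - t) *: y| <= t * `|x| + (1 - t) * `|y|.
  apply: le_trans (ler_normD _ _) _.
  by rewrite !normrZ !ger0_norm// subr_ge0.
apply: le_trans (_ : _ <= (t * `|x| + (1 - t) * `|y|) ^+ 2) _.
  by rewrite lerXn2r// nnegrE// addr_ge0// mulr_ge0// subr_ge0.
rewrite -subr_ge0.
have -> : t * `|x| ^+ 2 + (1 - t) * `|y| ^+ 2 - (t * `|x| + (1 - t) * `|y|) ^+ 2
  = t * (1 - t) * (`|x| - `|y|) ^+ 2 by ring.
by apply: mulr_ge0; rewrite ?sqr_ge0// mulr_ge0// subr_ge0.
Qed.

(** By convexity of the squared norm, since [x + t *: y] lies on the segment from [x] to [x + y]. *)
Lemma duality_subgradient x y : `|x| ^+ 2 + 2 * J x y <= `|x + y| ^+ 2.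
Proof.
suff : J x y <= (`|x + y| ^+ 2 - `|x| ^+ 2) / 2 by lra.
apply: duality_le_quotient => e e0; exists 1 => // t t0 t1.
have -> : x + t *: y = t *: (x + y) + (1 - t) *: x.
  by rewrite scalerDr addrAC -scalerDl addrC [t + _]addrC subrK scale1r addrC.
have := @sqnorm_convex (x + y) x t; rewrite (ltW t0) t1 => /(_ isT).
have : 0 < t * e by rewrite mulr_gt0.
lra.
Qed.

(** Positive factors are absorbed by rescaling the step. Negative ones use that the derivative is
    two-sided, so the step may change sign. *)
Lemma dualityZ x y t : J x (t *: y) = t * J x y.
Proof.
have pos (s : R) z : 0 < s -> J x (s *: z) <= s * J x z.
  move=> s0; apply: duality_le_quotient => e e0.
  have [d d0 hd] := JP z `|x| (divr_gt0 e0 s0).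
  exists (d / s); first exact: divr_gt0.
  move=> r r0; rewrite ler_pdivlMr// => rsd.
  have rs0 : 0 < r * s by rewrite mulr_gt0.
  have := hd x (r * s) (lexx _); rewrite (gtr0_norm rs0) => /(_ rsd).
  rewrite scalerA ler_norml => /andP[_].
  rewrite [e / s * _]mulrCA divfK ?gt_eqF//; lra.
have neg z : J x (- z) <= - J x z.
  apply: duality_le_quotient => e e0.
  have [d d0 hd] := JP z `|x| e0.
  exists d => // r r0 rd.
  have := hd x (- r) (lexx _); rewrite normrN (gtr0_norm r0) => /(_ rd).
  by rewrite scaleNr scalerN ler_norml => /andP[_]; lra.
have negE z : J x (- z) = - J x z.
  apply/eqP; rewrite eq_le neg /=; apply: duality_ge_quotient => e e0.
  have [d d0 hd] := JP z `|x| e0.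
  exists d => // r r0 rd.
  have := hd x (- r) (lexx _); rewrite normrN (gtr0_norm r0) => /(_ rd).
  by rewrite scaleNr scalerN ler_norml => /andP[+ _]; lra.
have posE (s : R) z : 0 < s -> J x (s *: z) = s * J x z.
  move=> s0; apply/eqP; rewrite eq_le pos//=.
  have := pos s (- z) s0; rewrite scalerN !negE; lra.
have zero : J x 0 = 0 by have := negE 0; rewrite oppr0; lra.
have [t0|t0|->] := ltgtP t 0; last by rewrite scale0r mul0r.
- by rewrite -{1}[t]opprK scaleNr negE posE ?oppr_gt0// mulNr opprK.
- exact: posE.
Qed.

Lemma dualityN x y : J x (- y) = - J x y.
Proof. by rewrite -scaleN1r dualityZ mulN1r. Qed.

(** The midpoint of [x + 2tu] and [x + 2tv] is [x + t(u + v)], so convexity yields subadditivity;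
    oddness in the direction gives the converse. *)
Lemma dualityD x y z : J x (y + z) = J x y + J x z.
Proof.
have sub u v : J x (u + v) <= J x u + J x v.
  apply: duality_le_quotient => e e0; have e20 : 0 < e / 2 by lra.
  have [d d0 hd] := JP (2 *: u) `|x| e20.
  have [d' d'0 hd'] := JP (2 *: v) `|x| e20.
  exists (Num.min d d'); first by rewrite lt_min d0.
  move=> t t0; rewrite le_min => /andP[td td'].
  have := hd x t (lexx _); have := hd' x t (lexx _).
  rewrite !(gtr0_norm t0) => /(_ td'); rewrite ler_norml => /andP[_ h1].
  move=> /(_ td); rewrite ler_norml => /andP[_ h2].
  have h01 : 0 <= (2^-1 : R) <= 1 by lra.
  have := sqnorm_convex (x + t *: (2 *: u)) (x + t *: (2 *: v)) h01.
  have -> : (1 - 2^-1 : R) = 2^-1 by field.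
  have -> : 2^-1 *: (x + t *: (2 *: u)) + 2^-1 *: (x + t *: (2 *: v)) =
            x + t *: (u + v).
    rewrite -scalerDr addrACA -!scalerDr scalerA [t * 2]mulrC -scalerA.
    by rewrite -[x + x]mulr2n -[x *+ 2]scaler_nat -scalerDr scalerA mulVf ?scale1r//.
  move=> h3.
  have : 0 < t * e by rewrite mulr_gt0.
  by rewrite !dualityZ in h1 h2; lra.
apply/eqP; rewrite eq_le sub /=.
by have := sub (- y) (- z); rewrite -opprD !dualityN; lra.
Qed.

Lemma dualityB x y z : J x (y - z) = J x y - J x z.
Proof. by rewrite dualityD dualityN. Qed.

Lemma dualityNl x y : J (- x) y = - J x y.
Proof.
have h e : 0 < e -> exists2 d : R, 0 < d & forall t, 0 < t -> t <= d ->
    `| `|- x + t *: y| ^+ 2 - `|x| ^+ 2 + 2 * t * J x y| <= e * t.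
  move=> e0; have [d d0 hd] := JP y `|x| e0; exists d => // t t0 td.
  have := hd x (- t) (lexx _); rewrite normrN (gtr0_norm t0) => /(_ td).
  rewrite -[`|x + _|]normrN opprD -scaleNr opprK.
  by rewrite mulrN mulNr opprK.
apply/eqP; rewrite eq_le; apply/andP; split.
  apply: duality_le_quotient => e /h[d d0 hd]; exists d => // t t0 td.
  by have := hd t t0 td; rewrite normrN ler_norml => /andP[_]; lra.
apply: duality_ge_quotient => e /h[d d0 hd]; exists d => // t t0 td.
by have := hd t t0 td; rewrite normrN ler_norml => /andP[+ _]; lra.
Qed.

Lemma duality_norm x : J x x = `|x| ^+ 2.
Proof.
have E1 (t : R) : 0 < t ->
    `|x + t *: x| ^+ 2 = (1 + t) ^+ 2 * `|x| ^+ 2.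
  move=> t0; rewrite -{1}[x]scale1r -scalerDl normrZ exprMn gtr0_norm//; lra.
apply/eqP; rewrite eq_le; apply/andP; split.
  apply: duality_le_quotient => e e0.
  have p0 : 0 < `|x| ^+ 2 + 1 by rewrite ltr_wpDl// ?sqr_ge0.
  exists (e / (`|x| ^+ 2 + 1)); first by rewrite divr_gt0.
  move=> t t0 td; rewrite E1//.
  have : t * (t * `|x| ^+ 2) <= t * e.
    rewrite ler_pM2l//; rewrite ler_pdivlMr// in td.
    by apply: le_trans td; rewrite ler_pM2l// lerDl.
  lra.
apply: duality_ge_quotient => e e0; exists 1 => // t t0 t1; rewrite E1//.
have : 0 <= t * (t * `|x| ^+ 2) by rewrite !(mulr_ge0 (ltW t0))// ?sqr_ge0.
have : 0 < t * e by rewrite mulr_gt0.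
lra.
Qed.

Lemma duality_le x y : J x y <= `|x| * `|y|.
Proof.
apply: duality_le_quotient => e e0.
have p0 : 0 < `|y| ^+ 2 + 1 by rewrite ltr_wpDl// ?sqr_ge0.
exists (e / (`|y| ^+ 2 + 1)); first by rewrite divr_gt0.
move=> t t0 td.
have h : `|x + t *: y| <= `|x| + t * `|y|.
  by apply: le_trans (ler_normD _ _) _; rewrite normrZ gtr0_norm.
have h2 : `|x + t *: y| ^+ 2 <= (`|x| + t * `|y|) ^+ 2.
  by rewrite lerXn2r// nnegrE// addr_ge0// mulr_ge0// ltW.
have : t * (t * `|y| ^+ 2) <= t * e.
  rewrite ler_pM2l//; rewrite ler_pdivlMr// in td.
  by apply: le_trans td; rewrite ler_pM2l// lerDl.
lra.
Qed.

Lemma duality_le_norm x y : `|J x y| <= `|x| * `|y|.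
Proof.
by rewrite ler_norml duality_le andbT lerNl -dualityN -[`|y|]normrN duality_le.
Qed.

(** For one fixed step [t] the difference quotient approximates [J] uniformly on the ball, and this
    quotient is Lipschitz on bounded sets. *)
Lemma duality_uniformly_continuous y M e : 0 < e -> exists2 d : R, 0 < d &
  forall x z, `|x| <= M -> `|z| <= M -> `|x - z| <= d -> `|J x y - J z y| <= e.
Proof.
move=> e0; have e20 : 0 < e / 2 by lra.
have [t t0 ht] := JP y M e20.
(* The Lipschitz constants of the two squared norms add up to the first two terms; the last makes
   [K] positive. *)
pose K := 4 * `|M| + 4 * t * `|y| + 1.
have K0 : 0 < K by rewrite ltr_wpDl// addr_ge0// !mulr_ge0// ltW.
exists (t * e / K); first by rewrite divr_gt0// mulr_gt0.
move=> x z xM zM; rewrite ler_pdivlMr// => xz.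
have tt : `|t| <= t by rewrite gtr0_norm.
have := ht x t xM tt; have := ht z t zM tt.
rewrite (gtr0_norm t0) !ler_norml => /andP[h1 h2] /andP[h3 h4].
have sq (a b : E) : `|a| <= `|M| + t * `|y| -> `|b| <= `|M| + t * `|y| ->
    `|a| ^+ 2 - `|b| ^+ 2 <= `|a - b| * (2 * (`|M| + t * `|y|)).
  move=> aM bM; rewrite subr_sqr.
  apply: le_trans (_ : _ <= `|a - b| * (`|a| + `|b|)) _.
    by rewrite ler_wpM2r ?addr_ge0// lerB_dist.
  by rewrite ler_wpM2l//; lra.
have nM := ler_norm M; have tyn : 0 <= t * `|y| by rewrite mulr_ge0// ltW.
have xy : `|x + t *: y| <= `|M| + t * `|y|.
  by apply: le_trans (ler_normD _ _) _; rewrite normrZ (gtr0_norm t0); lra.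
have zy : `|z + t *: y| <= `|M| + t * `|y|.
  by apply: le_trans (ler_normD _ _) _; rewrite normrZ (gtr0_norm t0); lra.
have xM' : `|x| <= `|M| + t * `|y| by lra.
have zM' : `|z| <= `|M| + t * `|y| by lra.
have := sq _ _ xy zy; have := sq _ _ zy xy.
have := sq _ _ xM' zM'; have := sq _ _ zM' xM'.
rewrite [`|z - x|]distrC.
have -> : x + t *: y - (z + t *: y) = x - z by rewrite opprD addrACA subrr addr0.
have -> : z + t *: y - (x + t *: y) = z - x by rewrite opprD addrACA subrr addr0.
rewrite [`|z - x|]distrC => k1 k2 k3 k4.
have {}xz : `|x - z| * (4 * `|M| + 4 * t * `|y|) <= t * e.
  by apply: le_trans xz; rewrite ler_wpM2l// lerDl.
have a1 : t * (J x y - J z y) <= t * e by lra.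
have a2 : t * (- e) <= t * (J x y - J z y) by lra.
by rewrite !(ler_pM2l t0) in a1 a2; rewrite a1 a2.
Qed.

End duality_map_theory.

(** * Resolvents and sunny nonexpansive retractions *)

Section convex_minimization.
Context {R : realType} {E : normedModType R}.
Implicit Types (C : set E) (g : E -> R) (x y : E).

Lemma convex_setE C x y (t : R) : convex_set C -> 0 <= t <= 1 -> C x -> C y ->
  C (t *: x + (1 - t) *: y).
Proof.
move=> cC /andP[t0 t1] Cx Cy.
by have := cC x y (Itv01 t0 t1) (mem_set Cx) (mem_set Cy); rewrite inE.
Qed.

Lemma shortmap_continuous g : shortmap g -> continuous g.
Proof.
move=> sg x; apply/cvgrPdist_le => e e0; near=> z.
apply: le_trans (_ : `|x - z| <= e); last by near: z; exact: cvgr_dist_le.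
rewrite ler_norml; have := sg x z; have := sg z x; rewrite (distrC z x); lra.
Unshelve. all: by end_near. Qed.

Lemma convex_norm_distance y : convex_functional (fun x => `|x - y|).
Proof.
move=> a b t /andP[t0 t1].
have -> : t *: a + (1 - t) *: b - y = t *: (a - y) + (1 - t) *: (b - y).
  rewrite [t *: (_ - _)]scalerBr [(1 - t) *: (_ - _)]scalerBr addrACA -opprD.
  by rewrite -scalerDl [t + _]addrC subrK scale1r.
apply: le_trans (ler_normD _ _) _.
by rewrite !normrZ !ger0_norm// subr_ge0.
Qed.

(** Being convex and 1-Lipschitz, the distance is weakly lower semicontinuous; this is how closed
    convex sets are seen to contain weak limits. *)
Let distance C y := inf [set `|y - c| | c in C].

Lemma distance_le C y c : C c -> distance C y <= `|y - c|.
Proof.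
move=> Cc; apply: (@inf_lb_le _ _ _ 0); first by exists c.
by move=> _ [d _ <-].
Qed.

Lemma distance_lt C y (e : R) : C !=set0 -> 0 < e ->
  exists2 c, C c & `|y - c| < distance C y + e.
Proof.
move=> [c0 Cc0] e0; have [||_ [c Cc <-] h] := @inf_lb_lt_ex _ [set `|y - c| | c in C]
  `|y - c0| 0 e _ _ e0; [by exists c0 | by move=> _ [c _ <-] | by exists c].
Qed.

Lemma shortmap_distance C : C !=set0 -> shortmap (distance C).
Proof.
move=> C0 x y; apply/ler_addgt0Pr => e e0.
have [c Cc hc] := distance_lt y C0 e0.
have := distance_le x Cc; have := ler_distD y x c; lra.
Qed.

Lemma convex_distance C : C !=set0 -> convex_set C -> convex_functional (distance C).
Proof.
move=> C0 cC x y t t01; apply/ler_addgt0Pr => e e0.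
have [c Cc hc] := distance_lt x C0 e0.
have [d Cd hd] := distance_lt y C0 e0.
have := distance_le (t *: x + (1 - t) *: y) (convex_setE cC t01 Cc Cd).
move: t01 => /andP[t0 t1].
have -> : t *: x + (1 - t) *: y - (t *: c + (1 - t) *: d) =
          t *: (x - c) + (1 - t) *: (y - d).
  by rewrite opprD addrACA !scalerBr.
have := ler_normD (t *: (x - c)) ((1 - t) *: (y - d)).
rewrite !normrZ !ger0_norm ?subr_ge0// => h1 h2.
have : t * `|x - c| <= t * (distance C x + e) by rewrite ler_wpM2l// ltW.
have : (1 - t) * `|y - d| <= (1 - t) * (distance C y + e).
  by rewrite ler_wpM2l ?subr_ge0// ltW.
lra.
Qed.

Lemma closed_distance_le0 C y : closed C -> C !=set0 -> distance C y <= 0 -> C y.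
Proof.
move=> clC C0 dy; apply: clC => A; rewrite -nbhs_ballE.
move=> [e /= e0 hA]; have [c Cc hc] := distance_lt y C0 e0.
by exists c; split=> //; apply: hA; rewrite -ball_normE /=; lra.
Qed.

(** The coercivity bound makes a minimizing sequence bounded. Its weak limit lies in [C] by lower
    semicontinuity of the distance, and is a minimizer by that of [g]. *)
Lemma convex_coercive_attains_min C g (K : R) :
  reflexive_space E -> closed C -> convex_set C -> C !=set0 ->
  convex_functional g -> shortmap g -> (forall y, `|y| <= g y + K) ->
  exists2 c, C c & forall y, C y -> g c <= g y.
Proof.
move=> rE clC cC [c0 Cc0] cg sg coer.
have C0 : C !=set0 by exists c0.
pose A := [set g y | y in C]; pose m := inf A.
have lbA : lbound A (- K).
  by move=> _ [y _ <-]; have := coer y; have := normr_ge0 y; lra.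
have Ac0 : A (g c0) by exists c0.
have /choice[y yP] : forall n : nat, exists y, C y /\ g y < m + n.+1%:R^-1.
  move=> n; have n0 : 0 < (n.+1%:R^-1 : R) by rewrite invr_gt0.
  by have [_ [y Cy <-] h] := inf_lb_lt_ex Ac0 lbA n0; exists y.
(* [U] refines convergence at infinity, so ordinary limits remain limits along [U]. *)
have [U [UU ooU]] := ultraFilterLemma (eventually_filter).
have yM n : `|y n| <= m + 1 + K.
  have := coer (y n); have := (yP n).2.
  have : (n.+1%:R^-1 : R) <= 1 by rewrite invf_le1// ler1n.
  move: (n.+1%:R^-1 : R) => r; lra.
have [x yx] := reflexive_weak_limit rE UU yM.
exists x.
  apply: closed_distance_le0 => //.
  apply: (convex_weak_lsc _ yx (convex_distance C0 cC) (shortmap_distance C0)).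
  suff -> : (fun n => distance C (y n)) = (fun=> 0) by exact: cvg_cst.
  apply/funext => n; apply/eqP; rewrite eq_le; apply/andP; split.
    by have := distance_le (y n) (yP n).1; rewrite subrr normr0.
  apply: lb_le_inf; first by exists `|y n - c0|, c0.
  by move=> _ [c _ <-].
move=> z Cz; have mz : m <= g z by apply: inf_lb_le lbA; exists z.
apply: le_trans mz; apply: (convex_weak_lsc _ yx cg sg).
apply: (@cvg_trans _ (g (y n) @[n --> \oo])); first by move=> B /ooU.
have h : m + n.+1%:R^-1 @[n --> \oo] --> m + (0 : R).
  by apply: cvgD; [exact: cvg_cst | exact: cvg_harmonic].
rewrite addr0 in h; apply: squeeze_cvgr (cvg_cst m) h.
apply: nearW => n; have [Cy gy] := yP n; rewrite (ltW gy) andbT.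
by apply: inf_lb_le lbA; exists (y n).
Qed.

End convex_minimization.

(** * Resolvents and asymptotic centers of nonexpansive mappings *)

Section nonexpansive_maps.
Context {R : realType} {E : completeNormedModType R}.
Implicit Types (C K : set E) (T Q : E -> E) (u x y z w p q : E).

Lemma nonexpansiveE C T x y : nonexpansive C T -> C x -> C y ->
  `|T x - T y| <= `|x - y|.
Proof. by move=> nT Cx Cy; have := nT (x, y) (conj Cx Cy); rewrite /= mul1r. Qed.

Lemma nonexpansiveI C T :
  (forall x y, C x -> C y -> `|T x - T y| <= `|x - y|) -> nonexpansive C T.
Proof. by move=> h [x y] [/= Cx Cy]; rewrite mul1r h. Qed.

Lemma resolvent_exists C T u (t : R) : closed C -> convex_set C -> C u ->
  set_fun C C T -> nonexpansive C T -> 0 < t <= 1 ->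
  exists2 z, C z & z = t *: u + (1 - t) *: T z.
Proof.
move=> clC cC Cu TC nT /andP[t0 t1].
pose f z := t *: u + (1 - t) *: T z.
have fC : set_fun C C f.
  by move=> z Cz; apply: convex_setE => //; [rewrite t1 ltW | exact: TC].
have t1' : 0 <= 1 - t by rewrite subr_ge0.
have ctr : is_contraction (mkfun_fun fC).
  exists (NngNum t1'); split=> /=; first by lra.
  move=> [x y] [/= Cx Cy]; rewrite /f opprD addrACA subrr add0r -scalerBr normrZ.
  by rewrite ger0_norm// ler_wpM2l//; exact: nonexpansiveE nT Cx Cy.
by have [|z Cz zf] := banach_fixed_point ctr clC; [exists u | exists z].
Qed.

Lemma asymptotic_center_fixed_point C T (U : set_system nat) (z : nat -> E) (M : R) :
  reflexive_space E -> fixed_point_property E ->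
  closed C -> convex_set C -> C !=set0 -> set_fun C C T -> nonexpansive C T ->
  UltraFilter U -> (forall n, C (z n)) -> (forall n, `|z n| <= M) ->
  z n - T (z n) @[n --> U] --> (0 : E) ->
  exists p l, [/\ fixed_points C T p, `|z n - p| @[n --> U] --> l &
    forall y m, C y -> `|z n - y| @[n --> U] --> m -> l <= m].
Proof.
move=> rE fE clC cC C0 TC nT UU Cz zM zT.
have PU : ProperFilter U := ultra_proper.
pose g y : R := lim (`|z n - y| @[n --> U]).
have gE y : `|z n - y| @[n --> U] --> g y.
  apply: (@ultra_bounded_cvg _ _ _ _ (M + `|y|)) => n; rewrite normr_id.
  by apply: le_trans (ler_normB _ _) _; rewrite lerD2r.
have cg : convex_functional g.
  move=> x y t t01.
  apply: (ler_cvg_to (gE _)) (_ : t * `|z n - x| + (1 - t) * `|z n - y| @[n --> U] --> _) _.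
    by apply: cvgD; apply: cvgM => //; exact: cvg_cst.
  apply: nearW => n; have := @convex_norm_distance _ _ (z n) x y t t01.
  by rewrite /= ![in X in X -> _](distrC _ (z n)).
have sg : shortmap g.
  move=> x y; apply: (ler_cvg_to (gE x)) (_ : `|z n - y| + `|x - y| @[n --> U] --> _) _.
    by apply: cvgD => //; exact: cvg_cst.
  by apply: nearW => n; rewrite (distrC x y); exact: ler_distD.
have coer y : `|y| <= g y + M.
  apply: (ler_cvg_to (cvg_cst `|y|)) (_ : `|z n - y| + M @[n --> U] --> _) _.
    by apply: cvgD => //; exact: cvg_cst.
  apply: nearW => n; have := ler_normD (y - z n) (z n).
  by rewrite subrK distrC; have := zM n; lra.
have [c Cc cmin] := convex_coercive_attains_min rE clC cC C0 cg sg coer.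
(* As [z n] is asymptotically fixed, [|z n - T y|] is at most [|T (z n) - T y|] up to a null
   term. *)
have gT y : C y -> g (T y) <= g y.
  move=> Cy; rewrite -[leRHS]add0r.
  apply: (ler_cvg_to (gE (T y)))
    (_ : `|z n - T (z n)| + `|z n - y| @[n --> U] --> 0 + g y) _.
    by apply: cvgD => //; rewrite -[X in _ --> X](@normr0 _ E); exact: cvg_norm.
  apply: nearW => n; apply: le_trans (ler_distD (T (z n)) _ _) _.
  by rewrite lerD2l; exact: nonexpansiveE nT (Cz n) Cy.
(* The minimizers of [g] on [C], written as a sublevel set so that closedness, convexity and
   invariance are inherited from [g]. *)
pose D := [set y | C y /\ g y <= g c].
have [||||||p [Cp gp] Tp] := fE D _ _ _ _ T.
- by exists c; split.
- exists (g c + M); split; first exact: num_real.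
  by move=> r gr y [_ gy]; apply: le_trans (coer y) _;
    apply: le_trans (ltW gr); rewrite lerD2r.
- apply: closedI => //; apply: (@closed_comp _ _ g [set r | r <= g c]).
    by move=> y _; exact: shortmap_continuous.
  exact: closed_le.
- move=> x y t; rewrite !inE => -[Cx gx] [Cy gy].
  have t01 : 0 <= t%:num <= 1 by rewrite ge0 le1.
  split; first exact: (convex_setE cC t01 Cx Cy).
  apply: le_trans (cg x y _ t01) _; move: t01 => /andP[t0 t1].
  have : t%:num * g x <= t%:num * g c by rewrite ler_wpM2l.
  have : (1 - t%:num) * g y <= (1 - t%:num) * g c by rewrite ler_wpM2l// subr_ge0.
  by move: (t%:num) => s; lra.
- move=> y [Cy gy]; split; first exact: TC.
  exact: le_trans (gT y Cy) gy.
- apply: nonexpansiveI => x y [Cx _] [Cy _]; exact: nonexpansiveE nT Cx Cy.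
exists p, (g p); split=> // y m Cy ym.
have <- : g y = m by apply: (cvg_unique _ (gE y) ym); exact: norm_hausdorff.
exact: le_trans gp (cmin y Cy).
Qed.
End nonexpansive_maps.

(** * Cluster points of the resolvent curve *)

Section sunny_retraction.
Context {R : realType} {E : completeNormedModType R}.
Variable J : E -> E -> R.
Hypothesis JP : duality_map J.
Implicit Types (C K : set E) (T Q : E -> E) (u x y z w p q : E).

Lemma resolvent_dist C T u z q (t : R) : nonexpansive C T -> 0 < t <= 1 ->
  C z -> fixed_points C T q -> z = t *: u + (1 - t) *: T z ->
  `|z - q| <= `|u - q|.
Proof.
move=> nT /andP[t0 t1] Cz [Cq Tq] zE.
have h : z - q = t *: (u - q) + (1 - t) *: (T z - q).
  rewrite {1}zE !scalerBr addrACA -opprD -scalerDl [t + _]addrC subrK.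
  by rewrite scale1r.
have := ler_normD (t *: (u - q)) ((1 - t) *: (T z - q)).
rewrite -h !normrZ (gtr0_norm t0) ger0_norm ?subr_ge0// => h1.
have : (1 - t) * `|T z - q| <= (1 - t) * `|z - q|.
  by rewrite ler_wpM2l ?subr_ge0// -{1}Tq; exact: nonexpansiveE nT Cz Cq.
by move=> h2; rewrite -(ler_pM2l t0); lra.
Qed.

Lemma resolvent_residual T u z (t : R) :
  z = t *: u + (1 - t) *: T z -> z - T z = t *: (u - T z).
Proof.
by move=> zE; rewrite {1}zE scalerBl scale1r addrA addrAC addrK scalerBr.
Qed.

(** The operator [I - T] is accretive ([mono] below), and the resolvent equation reads
    [t (u - z) = (1 - t) (z - T z)]. *)
Lemma resolvent_duality_le C T u z w (t : R) : nonexpansive C T -> 0 < t <= 1 ->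
  C z -> C w -> z = t *: u + (1 - t) *: T z ->
  t * J (w - z) (u - z) <= `|w - z| * `|w - T w|.
Proof.
move=> nT /andP[t0 t1] Cz Cw zE.
have e1 : t *: (u - z) = (1 - t) *: (z - T z).
  rewrite (resolvent_residual zE) scalerA [(1 - t) * t]mulrC -scalerA.
  by congr (_ *: _); rewrite {1}zE opprD addrA [RHS]scalerBr
    [X in _ = X - _]scalerBl scale1r.
have mono : J (z - w) (w - T w) <= J (z - w) (z - T z).
  rewrite -subr_ge0 -(dualityB JP).
  have -> : z - T z - (w - T w) = (z - w) - (T z - T w).
    by rewrite !opprD !opprK addrACA.
  rewrite (dualityB JP) (duality_norm JP).
  have := duality_le JP (z - w) (T z - T w).
  have : `|z - w| * `|T z - T w| <= `|z - w| * `|z - w|.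
    by rewrite ler_wpM2l//; exact: nonexpansiveE nT Cz Cw.
  lra.
rewrite -(dualityZ JP) e1 -[w - z]opprB (dualityNl JP) (dualityZ JP) normrN.
have := duality_le_norm JP (z - w) (w - T w).
rewrite ler_norml => /andP[h _].
have h2 : (1 - t) * - J (z - w) (z - T z) <= (1 - t) * (`|z - w| * `|w - T w|).
  by rewrite ler_wpM2l ?subr_ge0//; lra.
have : 0 <= t * (`|z - w| * `|w - T w|) by rewrite !mulr_ge0// ltW.
lra.
Qed.

Hypothesis E_reflexive : reflexive_space E.
Hypothesis E_fpp : fixed_point_property E.

Section resolvent_curve.
Variables (C : set E) (T : E -> E).
Hypotheses (clC : closed C) (cC : convex_set C).
Hypotheses (TC : set_fun C C T) (nT : nonexpansive C T).
Hypothesis F0 : fixed_points C T !=set0.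

(** Only norm approximation of [p] by resolvent points is recorded, with no condition linking [t] to
    [e]. *)
Let curve_cluster u p := forall e : R, 0 < e -> exists z (t : R),
  [/\ 0 < t <= 1, C z, z = t *: u + (1 - t) *: T z & `|z - p| <= e].

Lemma resolvent_curve_cluster u : C u ->
  exists2 p, fixed_points C T p & curve_cluster u p.
Proof.
move=> Cu; have [q Fq] := F0.
have C0 : C !=set0 by exists u.
have t01 (n : nat) : 0 < (n.+1%:R^-1 : R) <= 1.
  by rewrite invr_gt0 ltr0n/= invf_le1// ler1n.
have /choice[z zP] : forall n : nat, exists z,
    C z /\ z = n.+1%:R^-1 *: u + (1 - n.+1%:R^-1) *: T z.
  by move=> n; have [z Cz zE] := resolvent_exists clC cC Cu TC nT (t01 n); exists z.
have zq n : `|z n - q| <= `|u - q|.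
  by have [Cz zE] := zP n; exact: resolvent_dist nT (t01 n) Cz Fq zE.
have zM n : `|z n| <= `|u - q| + `|q|.
  by have := ler_normD (z n - q) q; rewrite subrK; have := zq n; lra.
have [U [UU ooU]] := ultraFilterLemma (eventually_filter).
have PU : ProperFilter U := ultra_proper.
have zT : z n - T (z n) @[n --> U] --> (0 : E).
  apply: (@cvg_trans _ (z n - T (z n) @[n --> \oo])); first by move=> B /ooU.
  apply/norm_cvg0P.
  have h : n.+1%:R^-1 * (2 * `|u - q|) @[n --> \oo] --> 0 * (2 * `|u - q|).
    by apply: cvgM; [exact: cvg_harmonic | exact: cvg_cst].
  rewrite mul0r in h; apply: squeeze_cvgr (cvg_cst 0) h.
  apply: nearW => n; have [Cz zE] := zP n; rewrite normr_ge0 /=.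
  rewrite (resolvent_residual zE) normrZ gtr0_norm; last by case/andP: (t01 n).
  rewrite ler_wpM2l ?invr_ge0//; apply: le_trans (ler_distD q _ _) _.
  have : `|q - T (z n)| <= `|z n - q|.
    by rewrite distrC -{1}Fq.2; exact: nonexpansiveE nT Cz Fq.1.
  by have := zq n; lra.
have [p [l [Fp pl pmin]]] := asymptotic_center_fixed_point E_reflexive E_fpp clC
  cC C0 TC nT UU (fun n => (zP n).1) zM zT.
have l0 : 0 <= l by apply: (cvgr_to_ge pl); exact: nearW.
suff lE : l = 0.
  exists p => // e e0.
  have : \forall n \near U, `|z n - p| < e.
    by apply: (cvgr_lt l) => //; rewrite lE.
  move=> /filter_ex[n ne]; exists (z n), n.+1%:R^-1.
  by have [Cz zE] := zP n; split=> //; exact: ltW.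
apply/eqP; rewrite eq_le l0 andbT.
suff : l ^+ 2 <= 0.
  by move=> l2; rewrite -(@ler_pXn2r _ 2)// ?nnegrE// expr0n.
apply/ler_addgt0Pr => e e0; rewrite add0r.
have [d d0 hd] := JP (u - p) (`|u - q| + `|q| + `|p|) e0.
(* The competitor [y] moves from [p] towards [u] by [s], small enough for the derivative estimate
   and at most 1 to stay in [C]. *)
pose s := Num.min d 1; have s0 : 0 < s by rewrite lt_min d0 ltr01.
have s1 : s <= 1 by rewrite ge_min lexx orbT.
have sd : `|- s| <= d by rewrite normrN gtr0_norm// ge_min lexx.
pose y := s *: u + (1 - s) *: p.
have Cy : C y by apply: convex_setE; rewrite ?(ltW s0) ?s1//; case: Fp.
have yE n : z n - y = z n - p + (- s) *: (u - p).
  rewrite /y scaleNr -addrA -opprD; congr (_ - _).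
  by rewrite scalerBl scale1r scalerBr addrCA.
(* Taking [w = p] in [resolvent_duality_le] gives [J (z n - p) (u - p) >= |z n - p|^2], so the step
   [s] lowers the squared distance by [2 s |z n - p|^2], up to [s e]. In the limit, minimality of
   [l] leaves [2 l^2 <= e]. *)
have key n : `|z n - y| ^+ 2 <= (1 - 2 * s) * `|z n - p| ^+ 2 + s * e.
  have zpM : `|z n - p| <= `|u - q| + `|q| + `|p|.
    by apply: le_trans (ler_normB _ _) _; rewrite lerD2r.
  have := hd _ _ zpM sd; rewrite -yE normrN (gtr0_norm s0) ler_norml => /andP[_].
  have [Cz zE] := zP n.
  have := resolvent_duality_le nT (t01 n) Cz Fp.1 zE.
  rewrite Fp.2 subrr normr0 mulr0 pmulr_rle0; last by case/andP: (t01 n).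
  rewrite -[p - z n]opprB (dualityNl JP) => h1.
  have : J (z n - p) (z n - p) <= J (z n - p) (u - p).
    rewrite -subr_ge0 -(dualityB JP).
    have -> : u - p - (z n - p) = u - z n by rewrite opprB addrA subrK.
    lra.
  rewrite (duality_norm JP) => h2 h3.
  have : s * `|z n - p| ^+ 2 <= s * J (z n - p) (u - p) by rewrite ler_pM2l.
  lra.
have ycvg : cvg (`|z n - y| @[n --> U]).
  apply: (@ultra_bounded_cvg _ _ _ _ (`|u - q| + `|q| + `|y|)) => n; rewrite normr_id.
  by apply: le_trans (ler_normB _ _) _; rewrite lerD2r.
have ly := pmin y _ Cy ycvg.
have : lim (`|z n - y| @[n --> U]) ^+ 2 <= (1 - 2 * s) * l ^+ 2 + s * e.
  apply: (ler_cvg_to (_ : `|z n - y| ^+ 2 @[n --> U] --> _)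
    (_ : (1 - 2 * s) * `|z n - p| ^+ 2 + s * e @[n --> U] --> _)).
  - by rewrite expr2; under eq_cvg do rewrite expr2; exact: cvgM.
  - apply: cvgD; last exact: cvg_cst; apply: cvgM; first exact: cvg_cst.
    by rewrite expr2; under eq_cvg do rewrite expr2; exact: cvgM.
  - exact: nearW.
have : l ^+ 2 <= lim (`|z n - y| @[n --> U]) ^+ 2.
  by rewrite lerXn2r// nnegrE// (le_trans l0).
move=> h1 h2; have : s * (2 * l ^+ 2) <= s * e by lra.
by rewrite ler_pM2l//; have := sqr_ge0 l; lra.
Qed.

(** A single resolvent point [z] near [p] suffices: its parameter [t] is then fixed, and [eta] may
    depend on it. Each of the three errors is at most [e / 3]. *)
Lemma cluster_duality_le u p (M e : R) : fixed_points C T p -> curve_cluster u p ->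
  0 < e -> exists2 eta : R, 0 < eta & forall w, C w -> `|w - p| <= M ->
    `|w - T w| <= eta -> J (w - p) (u - p) <= e.
Proof.
move=> Fp up e0; have e30 : 0 < e / 3 by lra.
pose B := `|M| + 1; have B0 : 0 < B by rewrite ltr_wpDl.
have [d d0 hd] := duality_uniformly_continuous JP (u - p) B e30.
(* The entries serve, in order, to replace [p] by [z] in the first argument, to keep [w - z] within
   [B], and to bound [J (w - z) (z - p)]. *)
pose r := Num.min (Num.min d 1) (e / (3 * B)).
have r0 : 0 < r.
  by rewrite !lt_min d0 ltr01 divr_gt0// mulr_gt0.
have [z [t [t01 Cz zE zp]]] := up r r0.
have t0 : 0 < t by case/andP: t01.
move: zp; rewrite !le_min => /andP[/andP[zd z1] ze].
exists (t * (e / (3 * B))); first by rewrite mulr_gt0// divr_gt0// mulr_gt0.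
move=> w Cw wM wT.
have M1 := ler_norm M.
have wz : `|w - z| <= B.
  by have := ler_distD p w z; rewrite (distrC p z) /B; lra.
have wp : `|w - p| <= B by rewrite /B; lra.
have h1 : `|J (w - p) (u - p) - J (w - z) (u - p)| <= e / 3.
  by apply: hd => //; rewrite opprB addrC addrA subrK.
have Be : B * (e / (3 * B)) = e / 3 by field; rewrite gt_eqF.
have h2 : J (w - z) (z - p) <= e / 3.
  by apply: le_trans (duality_le JP _ _) _; rewrite -Be; exact: ler_pM.
have h3 : J (w - z) (u - z) <= e / 3.
  rewrite -(ler_pM2l t0); apply: le_trans (resolvent_duality_le nT t01 Cz Cw zE) _.
  by rewrite -Be mulrCA; exact: ler_pM.
have : J (w - z) (u - p) = J (w - z) (u - z) + J (w - z) (z - p).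
  by rewrite -(dualityD JP) addrA subrK.
by move: h1; rewrite ler_norml => /andP[_]; lra.
Qed.

End resolvent_curve.
End sunny_retraction.

(** * The variational inequality and sunny nonexpansive retractions *)

Section variational_inequality.
Context {R : realType} {E : completeNormedModType R}.
Variable J : E -> E -> R.
Hypothesis JP : duality_map J.
Implicit Types (C K : set E) (T Q : E -> E) (u x y z w p q : E).

(** In a Hilbert space, for convex [K], this characterizes the metric projection [p] of [u] onto
    [K]. *)
Definition solves_vi K u p : Prop :=
  K p /\ forall q, K q -> J (q - p) (u - p) <= 0.

(** Testing each solution against the other and adding gives [|q - p|^2 <= 0]. *)
Lemma solves_vi_unique K u p q : solves_vi K u p -> solves_vi K u q -> p = q.
Proof.
move=> [Kp hp] [Kq hq]; have h1 := hp q Kq; have h2 := hq p Kp.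
have : J (q - p) (q - p) <= 0.
  have -> : J (q - p) (q - p) = J (q - p) (u - p) - J (q - p) (u - q).
    by rewrite -(dualityB JP) opprB [u - p + _]addrC addrA subrK.
  by rewrite -[in J (q - p) (u - q)]opprB (dualityNl JP); lra.
rewrite (duality_norm JP) => h3; apply/esym/eqP; rewrite -subr_eq0 -normr_eq0.
by rewrite -sqrf_eq0 eq_le h3 sqr_ge0.
Qed.

(** Moving along the ray from [Q x] through [x] only rescales the inequality by a nonnegative
    factor, hence sunniness. Adding the inequalities at [x] and [y] gives [|d|^2 <= J d (x - y)] for
    [d = Q x - Q y], hence nonexpansiveness. *)
Lemma solves_vi_sunny_nonexpansive C K Q : K `<=` C ->
  (forall u, C u -> solves_vi K u (Q u)) -> sunny_nonexpansive_retraction C K Q.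
Proof.
move=> KC hQ.
have QK x : K x -> Q x = x.
  move=> Kx; apply: solves_vi_unique (hQ x (KC x Kx)) _; split=> // q Kq.
  by rewrite subrr -(subrr 0) (dualityB JP) subrr.
split.
- split=> //; first by move=> x /hQ[].
  by move=> y Ky; exists y; [exact: KC | exact: QK].
- move=> x l Cx l0 Cw; apply: solves_vi_unique (hQ _ Cw) _.
  have [KQ hq] := hQ x Cx; split=> // q Kq.
  by rewrite addrAC subrr add0r (dualityZ JP) mulr_ge0_le0// hq.
- apply: nonexpansiveI => x y Cx Cy.
  have [KQx hx] := hQ x Cx; have [KQy hy] := hQ y Cy.
  have := hx _ KQy; have := hy _ KQx; rewrite -[Q y - Q x]opprB (dualityNl JP).
  set d := Q x - Q y => h1 h2.
  have e1 : J d d = J d (x - y) - J d (x - Q x) + J d (y - Q y).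
    rewrite -(dualityB JP) -(dualityD JP); congr (J d _).
    by rewrite opprB [x - y + _]addrC [Q x - x + _]addrA subrK addrA subrK.
  have h3 := duality_le JP d (x - y).
  have [->|d0] := eqVneq d 0; first by rewrite normr0.
  rewrite -(@ler_pM2l _ `|d|) ?normr_gt0// -expr2 -(duality_norm JP); lra.
Qed.

(** Points on the segment from [Q u] to [u] are all sent to [Q u], so none is closer to [q] than
    [Q u]; the derivative of the squared distance to [q] at [Q u] towards [u] is thus
    nonnegative. *)
Lemma sunny_nonexpansive_solves_vi C K Q u : convex_set C -> K `<=` C ->
  sunny_nonexpansive_retraction C K Q -> C u -> solves_vi K u (Q u).
Proof.
move=> cC KC [[QC _ QK] sQ nQ] Cu; have KQ := QC u Cu; split=> // q Kq.
rewrite -[q - _]opprB (dualityNl JP) oppr_le0.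
apply: (duality_ge_quotient JP) => e e0; exists 1 => // t t0 t1.
have wE : Q u + t *: (u - Q u) = t *: u + (1 - t) *: Q u.
  by rewrite scalerBl scale1r scalerBr addrCA.
have Cw : C (Q u + t *: (u - Q u)).
  by rewrite wE; apply: convex_setE; rewrite ?(ltW t0)//; exact: KC.
have h : `|Q u - q| <= `|Q u - q + t *: (u - Q u)|.
  rewrite addrAC -[Q u in leLHS](sQ u t Cu (ltW t0) Cw) -[q in leLHS](QK _ Kq).
  by apply: nonexpansiveE nQ Cw _; exact: KC.
have : `|Q u - q| ^+ 2 <= `|Q u - q + t *: (u - Q u)| ^+ 2.
  by rewrite lerXn2r// nnegrE.
have : 0 < t * e by rewrite mulr_gt0.
lra.
Qed.

End variational_inequality.

(** * Convergence of the iteration *)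

Section real_recursion.
Context {R : realType}.

(* The product of the factors [1 - alpha i] is at most                         *)
(* [1 / (1 + \sum_i alpha i)], which tends to 0.                               *)
Lemma contracting_recursion_le (alpha b : nat -> R) (c : R) (N : nat) :
  (forall n, 0 < alpha n <= 1) -> series alpha n @[n --> \oo] --> +oo -> 0 < c ->
  (forall n, (N <= n)%N -> b n.+1 <= (1 - alpha n) * b n + alpha n * c) ->
  \forall n \near \oo, b n <= 2 * c.
Proof.
move=> a01 sa c0 hb.
pose B := `|b N - c|; pose s n := series alpha n - series alpha N.
have sS n : s n.+1 = s n + alpha n.
  by rewrite /s seriesEord /= big_ord_recr/=; ring.
have s0 n : (N <= n)%N -> 0 <= s n.
  elim: n => [|n IHn]; first by rewrite leqn0 => /eqP <-; rewrite /s subrr.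
  rewrite leq_eqVlt => /orP[/eqP <-|/IHn h]; first by rewrite /s subrr.
  by rewrite sS addr_ge0//; have /andP[/ltW] := a01 n.
(* Preserved because [(1 - a) (1 + s + a) <= 1 + s] for nonnegative [a] and [s]. *)
have key n : (N <= n)%N -> (b n - c) * (1 + s n) <= B.
  elim: n => [|n IHn].
    rewrite leqn0 => /eqP N0; rewrite /s /B N0 subrr addr0 mulr1; exact: ler_norm.
  rewrite leq_eqVlt => /orP[/eqP <-|Nn].
    rewrite /s /B subrr addr0 mulr1; exact: ler_norm.
  have {}IHn := IHn Nn; have sn := s0 n Nn; have /andP[a0 a1] := a01 n.
  have hbn := hb n Nn; rewrite sS.
  have [bneg|bpos] := leP (b n.+1 - c) 0.
    apply: (@le_trans _ _ 0); last exact: normr_ge0.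
    by rewrite mulr_le0_ge0//; lra.
  have bn0 : 0 <= b n - c.
    rewrite leNgt; apply/negP => bn.
    have : (1 - alpha n) * (b n - c) <= 0 by rewrite mulr_ge0_le0//; lra.
    lra.
  apply: le_trans IHn.
  apply: (@le_trans _ _ ((1 - alpha n) * (b n - c) * (1 + (s n + alpha n)))).
    by rewrite ler_wpM2r//; lra.
  rewrite mulrAC [_ * (b n - c)]mulrC ler_wpM2l//.
  have : 0 <= alpha n * s n by rewrite mulr_ge0// ltW.
  have : 0 <= alpha n * alpha n by rewrite mulr_ge0// ltW.
  lra.
have /cvgryPge /(_ (series alpha N + B / c)) := sa.
apply: filterS2 (nbhs_infty_ge N) => n Nn sn.
have h : B / c <= s n by rewrite /s; lra.
have : (b n - c) * (1 + s n) <= c * (1 + s n).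
  apply: le_trans (key n Nn) _; rewrite ler_pdivrMr// in h; lra.
by rewrite ler_pM2r; have := s0 n Nn; lra.
Qed.

End real_recursion.

Section halpern_iteration.
Context {R : realType} {E : completeNormedModType R}.
Variable J : E -> E -> R.
Hypothesis JP : duality_map J.
Variables (C : set E) (S : nat -> E -> E) (T : E -> E) (alpha : nat -> R).
Variables (u p : E) (x : nat -> E).
Hypotheses (cC : convex_set C) (S_self : forall n, set_fun C C (S n)).
Hypotheses (T_self : set_fun C C T) (nT : nonexpansive C T).
Hypotheses (alpha_01 : forall n, 0 < alpha n <= 1) (Cu : C u) (Cx0 : C (x 0%N)).
Hypothesis x_rec : forall n, x n.+1 = alpha n *: u + (1 - alpha n) *: S n (x n).
Hypothesis alpha_cvg0 : alpha n @[n --> \oo] --> (0 : R).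
Hypothesis alpha_sum : series alpha n @[n --> \oo] --> +oo.
Hypothesis S_strong : strongly_nonexpansive_sequence C S.
Hypothesis S_NST : NST_condition_I C S T.
Hypothesis Fp : fixed_points C T p.

Let Cp : C p. Proof. exact: Fp.1. Qed.

Let Sp n : S n p = p.
Proof. by have [_ FS _] := S_NST; have [] := FS p Fp n I. Qed.

Let Cx n : C (x n).
Proof.
elim: n => [//|n Cxn]; rewrite x_rec; have /andP[a0 a1] := alpha_01 n.
by apply: convex_setE => //; [rewrite a1 ltW | exact: S_self].
Qed.

Let Sx_le n : `|S n (x n) - p| <= `|x n - p|.
Proof. by rewrite -{1}(Sp n); exact: nonexpansiveE (S_strong.1 n) (Cx n) Cp. Qed.

Let x_recB n : x n.+1 - p = alpha n *: (u - p) + (1 - alpha n) *: (S n (x n) - p).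
Proof.
rewrite x_rec [alpha n *: (u - p)]scalerBr [(1 - alpha n) *: (_ - p)]scalerBr.
by rewrite addrACA -opprD -scalerDl [alpha n + _]addrC subrK scale1r.
Qed.

Let M := Num.max `|x 0%N - p| `|u - p|.

Let uM : `|u - p| <= M. Proof. by rewrite le_max lexx orbT. Qed.

Let xM n : `|x n - p| <= M.
Proof.
elim: n => [|n IHn]; first by rewrite le_max lexx.
have /andP[a0 a1] := alpha_01 n.
rewrite x_recB; apply: le_trans (ler_normD _ _) _.
rewrite !normrZ gtr0_norm// ger0_norm ?subr_ge0//.
have : alpha n * `|u - p| <= alpha n * M by rewrite ler_pM2l.
have : (1 - alpha n) * `|S n (x n) - p| <= (1 - alpha n) * M.
  by rewrite ler_wpM2l ?subr_ge0// (le_trans (Sx_le n)).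
lra.
Qed.

(* [y] follows [x] along the range of [f] and is constantly the common fixed  *)
(* point [p] elsewhere, so that the sequential conditions on [S] apply to the *)
(* subsequence.                                                               *)
Let subsequence_residual (f : nat -> nat) : (forall k, (k <= f k)%N) ->
  (forall k, `|x (f k) - p| - `|S (f k) (x (f k)) - p| <= k.+1%:R^-1) ->
  forall e : R, 0 < e -> exists k,
    `|x (f k) - S (f k) (x (f k))| < e /\ `|x (f k) - T (x (f k))| < e.
Proof.
move=> fk fdef e e0.
pose y n := if `[< exists k, n = f k >] then x n else p.
have yP n : y n = p \/ y n = x n /\ exists k, n = f k.
  by rewrite /y; case: asboolP => h; [right|left].
have yf k : y (f k) = x (f k) by rewrite /y; case: asboolP => // -[]; exists k.
have Cy n : C (y n) by have [->|[-> _]] := yP n.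
have yM n : `|y n - p| <= M.
  by have [->|[-> _]] := yP n => //; rewrite subrr normr0 (le_trans _ uM).
have bdd : bounded_fun (fun n => y n - p).
  by exists M; split; [exact: num_real | move=> r Mr n _; exact: le_trans (ltW Mr)].
have defect : `|y n - p| - `|S n (y n) - S n p| @[n --> \oo] --> (0 : R).
  apply/cvgrPdist_lt => d d0.
  have : \forall k \near \oo, (k.+1%:R^-1 : R) < d.
    have := @cvg_harmonic R; move/cvgrPdist_lt => /(_ d d0).
    by apply: filterS => k; rewrite sub0r normrN ger0_norm /= ?invr_ge0.
  move=> [K _ hK].
  (* Beyond the first [K] values of [f], an index [n = f k] must have [k >= K]; at indices outside
     the range the defect is 0. *)
  exists (\max_(k < K) f k).+1 => // n /= Kn; rewrite sub0r normrN.
  have [->|[-> [k nk]]] := yP n; first by rewrite Sp subrr normr0.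
  have Kk : (K <= k)%N.
    rewrite leqNgt; apply/negP => kK; move: Kn; rewrite ltnNge => /negP; apply.
    by rewrite nk; exact: (@leq_bigmax_cond _ _ (fun k : 'I_K => f k) (Ordinal kK)).
  rewrite Sp ger0_norm ?subr_ge0//; rewrite nk; apply: le_lt_trans (fdef k) _.
  exact: hK.
have yS : y n - S n (y n) @[n --> \oo] --> (0 : E).
  have := S_strong.2 y (fun=> p) Cy (fun=> Cp) bdd defect.
  suff -> : (fun n => y n - p - (S n (y n) - S n p)) = (fun n => y n - S n (y n)) by [].
  by apply/funext => n; rewrite Sp opprB addrA subrK.
have bdy : bounded_fun y.
  exists (M + `|p|); split; first exact: num_real.
  move=> r Mr n _; apply: le_trans (ltW Mr).
  by have := ler_normD (y n - p) p; rewrite subrK; have := yM n; lra.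
have [_ _ /(_ y Cy bdy yS) yT] := S_NST.
move/cvgrPdist_lt: yS => /(_ e e0)[K1 _ h1].
move/cvgrPdist_lt: yT => /(_ e e0)[K2 _ h2].
exists (maxn K1 K2); set k := maxn _ _.
have k1 : (K1 <= f k)%N by rewrite (leq_trans _ (fk k))// leq_maxl.
have k2 : (K2 <= f k)%N by rewrite (leq_trans _ (fk k))// leq_maxr.
have := h1 _ k1; have := h2 _ k2.
by rewrite /= yf !sub0r !normrN.
Qed.

(** Otherwise each [d = 1 / (k + 1)] fails at some index [f k >= k], contradicting
    [subsequence_residual]. *)
Let small_defect (e : R) : 0 < e -> exists2 d : R, 0 < d & \forall n \near \oo,
  `|x n - p| - `|S n (x n) - p| <= d ->
  `|x n - S n (x n)| < e /\ `|x n - T (x n)| < e.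
Proof.
move=> e0; apply: contrapT => nd.
have /choice[f fP] : forall k, exists n, (k <= n)%N /\
    (`|x n - p| - `|S n (x n) - p| <= k.+1%:R^-1 /\
     ~ (`|x n - S n (x n)| < e /\ `|x n - T (x n)| < e)).
  move=> k; apply: contrapT => nk; apply: nd; exists k.+1%:R^-1.
    by rewrite invr_gt0.
  exists k => // n /= kn hn; apply: contrapT => h; apply: nk; exists n.
  by split.
have [k] := @subsequence_residual f (fun k => (fP k).1) (fun k => (fP k).2.1) e e0.
exact: (fP k).2.2.
Qed.

(** Plays the part of the usual upper limit bound on [J (x n - p) (u - p)], but pointwise: it
    applies to just those iterates that are almost fixed by [T]. *)
Hypothesis p_limsup : forall M e : R, 0 < e -> exists2 eta : R, 0 < eta &
  forall w, C w -> `|w - p| <= M -> `|w - T w| <= eta -> J (w - p) (u - p) <= e.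

Let sqdist_recursion (e : R) : 0 < e -> \forall n \near \oo,
  `|x n.+1 - p| ^+ 2 <= (1 - alpha n) * `|x n - p| ^+ 2 + alpha n * (2 * e).
Proof.
move=> e0; have [eta eta0 heta] := p_limsup M e0.
have eta8 : 0 < eta / 8 by lra.
have [d d0 hd] := small_defect eta8.
have M0 : 0 <= M := le_trans (normr_ge0 _) uM.
have [r1 r10 hr1] : exists2 r : R, 0 < r &
    forall a, 0 < a -> a < r -> 4 * (a * M) <= eta / 2.
  have M1 : 0 < 8 * (M + 1) by lra.
  exists (eta / (8 * (M + 1))); first by rewrite divr_gt0.
  by move=> a a0; rewrite ltr_pdivlMr//; lra.
have [r2 r20 hr2] : exists2 r : R, 0 < r &
    forall a, 0 < a -> a < r -> a * (2 * M ^+ 2 + d ^+ 2) <= d ^+ 2.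
  have dd : 0 < d ^+ 2 by rewrite exprn_gt0.
  have M1 : 0 < 2 * M ^+ 2 + d ^+ 2 by have := sqr_ge0 M; lra.
  exists (d ^+ 2 / (2 * M ^+ 2 + d ^+ 2)); first by rewrite divr_gt0.
  by move=> a a0; rewrite ltr_pdivlMr// => /ltW.
have a_lt r : 0 < r -> \forall n \near \oo, alpha n < r.
  by move=> r0; apply: (cvgr_lt 0).
have ar1 := a_lt _ r10; have ar2 := a_lt _ r20.
near=> n.
have /andP[a0 a1] := alpha_01 n.
have an1 : alpha n < r1 by near: n.
have an2 : alpha n < r2 by near: n.
(* The subgradient inequality at [x n.+1 - p] in the direction [- alpha n (u - p)], weakened by
   [(1 - alpha n)^2 <= 1 - alpha n]. *)
have step : `|x n.+1 - p| ^+ 2 <= (1 - alpha n) * `|S n (x n) - p| ^+ 2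
    + 2 * (alpha n * J (x n.+1 - p) (u - p)).
  have e1 : x n.+1 - p - alpha n *: (u - p) = (1 - alpha n) *: (S n (x n) - p).
    by rewrite x_recB addrAC subrr add0r.
  have := duality_subgradient JP (x n.+1 - p) (- (alpha n *: (u - p))).
  rewrite (dualityN JP) (dualityZ JP) e1 normrZ.
  rewrite exprMn ger0_norm ?subr_ge0//.
  have : (1 - alpha n) * (alpha n * `|S n (x n) - p| ^+ 2) >= 0.
    by apply: mulr_ge0; rewrite ?subr_ge0// mulr_ge0 ?sqr_ge0// ltW.
  lra.
apply: le_trans step _.
have [small|large] := leP (`|x n - p| - `|S n (x n) - p|) d.
  have [xS xT] : `|x n - S n (x n)| < eta / 8 /\ `|x n - T (x n)| < eta / 8.
    by move: small; near: n.
  have xx : `|x n.+1 - x n| <= 2 * (alpha n * M) + eta / 8.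
    have -> : x n.+1 - x n = alpha n *: (u - S n (x n)) + (S n (x n) - x n).
      rewrite x_rec addrA; congr (_ - _).
      by rewrite scalerBl scale1r scalerBr addrA addrAC.
    apply: le_trans (ler_normD _ _) _.
    rewrite [`|S n (x n) - x n|]distrC normrZ gtr0_norm//.
    have : `|u - S n (x n)| <= 2 * M.
      have := ler_distD p u (S n (x n)); rewrite (distrC p).
      by have := Sx_le n; have := xM n; have := uM; lra.
    rewrite -(ler_pM2l a0); lra.
  (* The residual is at most [2 |x n.+1 - x n| + |x n - T (x n)|], hence at most
     [4 alpha n M + 3 eta / 8]; [r1] bounds the first term by [eta / 2]. *)
  have xT1 : `|x n.+1 - T (x n.+1)| <= eta.
    have := ler_distD (x n) (x n.+1) (T (x n.+1)).
    have := ler_distD (T (x n)) (x n) (T (x n.+1)).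
    have := nonexpansiveE nT (Cx n) (Cx n.+1); rewrite (distrC (x n) (x n.+1)).
    have := hr1 _ a0 an1; lra.
  have := heta _ (Cx n.+1) (xM n.+1) xT1; rewrite -(ler_pM2l a0).
  have : (1 - alpha n) * `|S n (x n) - p| ^+ 2 <= (1 - alpha n) * `|x n - p| ^+ 2.
    by rewrite ler_wpM2l ?subr_ge0// lerXn2r// nnegrE.
  lra.
have JM : J (x n.+1 - p) (u - p) <= M ^+ 2.
  by apply: le_trans (duality_le JP _ _) _; rewrite expr2; exact: ler_pM.
(* The gain [(1 - alpha n) d^2] outweighs [2 alpha n M^2] by the choice of [r2]. *)
have Sd : `|S n (x n) - p| ^+ 2 <= `|x n - p| ^+ 2 - d ^+ 2.
  have Sn0 := normr_ge0 (S n (x n) - p).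
  have h1 : `|S n (x n) - p| ^+ 2 <= (`|x n - p| - d) ^+ 2.
    by rewrite lerXn2r// ?nnegrE; lra.
  have : d * d <= d * `|x n - p| by rewrite ler_pM2l//; lra.
  lra.
have : (1 - alpha n) * `|S n (x n) - p| ^+ 2 <=
       (1 - alpha n) * (`|x n - p| ^+ 2 - d ^+ 2).
  by rewrite ler_wpM2l ?subr_ge0.
have := hr2 _ a0 an2; have : 0 < alpha n * e by rewrite mulr_gt0.
have {}JM : alpha n * J (x n.+1 - p) (u - p) <= alpha n * M ^+ 2.
  by rewrite ler_pM2l.
move: JM; move: (J _ _) (`|S n (x n) - p|) (`|x n - p|) => v w z.
by move: M => m; lra.
Unshelve. all: by end_near. Qed.

Lemma halpern_cvg : x n @[n --> \oo] --> p.
Proof.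
apply/cvgrPdist_lt => e e0.
(* The recursion then has [c = e^2 / 4], so that eventually [|x n - p|^2 <= e^2 / 2]. *)
have e20 : 0 < e ^+ 2 / 8 by rewrite divr_gt0// exprn_gt0.
have [N _ hN] := sqdist_recursion e20.
have c0 : 0 < 2 * (e ^+ 2 / 8) by lra.
have := @contracting_recursion_le _ alpha (fun n => `|x n - p| ^+ 2) _ N alpha_01
  alpha_sum c0 hN.
apply: filterS => n h; rewrite distrC ltNge; apply/negP => he.
have : e ^+ 2 <= `|x n - p| ^+ 2 by rewrite lerXn2r// nnegrE// ltW.
have : 0 < e ^+ 2 by rewrite exprn_gt0.
lra.
Qed.

End halpern_iteration.

(** * Nonemptiness of the fixed point set and conclusion *)

Lemma NST_fixed_points_neq0 (R : realType) (E : completeNormedModType R)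
  (C : set E) (S : nat -> E -> E) (T : E -> E) :
  NST_condition_I C S T -> fixed_points C T !=set0.
Proof.
move=> [[q Fq] _ NST]; have [Cq _] := Fq 0%N I.
have qT : q - T q @[n --> \oo] --> (0 : E).
  (* The NST condition is applied to the constant sequence at a common fixed point, whose residuals
     vanish. *)
  apply: (NST (fun=> q)) => //.
    by exists `|q|; split; [exact: num_real | move=> r /ltW qr n _].
  suff -> : (fun n => q - S n q) = (fun=> 0) by exact: cvg_cst.
  by apply/funext => n; have [_ ->] := Fq n I; rewrite subrr.
exists q; split=> //; apply/esym/eqP; rewrite -subr_eq0; apply/eqP.
exact: (cvg_unique (@norm_hausdorff _ E) (cvg_cst (q - T q)) qT).
Qed.

Theorem theorem3p1 (R : realType) (E : completeNormedModType R)
  (E_reflexive : reflexive_space E)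
  (E_gateaux : uniformly_gateaux_differentiable_norm E)
  (E_fpp : fixed_point_property E)
  (C : set E) (C_neq0 : C !=set0) (C_closed : closed C) (C_convex : convex_set C)
  (S : nat -> E -> E) (S_self : forall n, set_fun C C (S n))
  (T : E -> E) (T_self : set_fun C C T) (T_nonexpansive : nonexpansive C T)
  (alpha : nat -> R) (alpha_01 : forall n, 0 < alpha n <= 1)
  (u : E) (Cu : C u)
  (x : nat -> E) (Cx0 : C (x 0%N))
  (x_rec : forall n, x n.+1 = alpha n *: u + (1 - alpha n) *: S n (x n))
  (alpha_cvg0 : alpha n @[n --> \oo] --> (0 : R))
  (alpha_sum : series alpha n @[n --> \oo] --> +oo)
  (S_strong : strongly_nonexpansive_sequence C S)
  (S_NST : NST_condition_I C S T) :
  (exists Q : E -> E, sunny_nonexpansive_retraction C (fixed_points C T) Q) /\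
  (forall Q : E -> E, sunny_nonexpansive_retraction C (fixed_points C T) Q ->
     x n @[n --> \oo] --> Q u).
Proof.
have [J JP] := duality_map_exists E_gateaux.
pose F := fixed_points C T.
have FC : F `<=` C by move=> q [].
have F0 : F !=set0 := NST_fixed_points_neq0 S_NST.
have curve v : C v -> exists2 p, F p & forall M e : R, 0 < e ->
    exists2 eta : R, 0 < eta & forall w, C w -> `|w - p| <= M ->
      `|w - T w| <= eta -> J (w - p) (v - p) <= e.
  move=> Cv; have [p Fp vp] := resolvent_curve_cluster JP E_reflexive E_fpp
    C_closed C_convex T_self T_nonexpansive F0 Cv.
  exists p => // M e e0.
  exact: (@cluster_duality_le _ _ _ JP _ _ T_nonexpansive v p M e Fp vp e0).
(* A fixed point has residual 0, below every [eta], so the bound holds at it for all [e > 0]. *)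
have curve_vi v p : F p -> (forall M e : R, 0 < e ->
    exists2 eta : R, 0 < eta & forall w, C w -> `|w - p| <= M ->
      `|w - T w| <= eta -> J (w - p) (v - p) <= e) -> solves_vi J F v p.
  move=> Fp hp; split=> // q Fq; apply/ler_addgt0Pr => e e0; rewrite add0r.
  have [eta eta0 h] := hp `|q - p| e e0; have [Cq Tq] := Fq.
  by apply: h => //; rewrite Tq subrr normr0 ltW.
split.
  have /choice[Q hQ] : forall v, exists p, C v -> solves_vi J F v p.
    move=> v; have [Cv|nCv] := pselect (C v); last by exists v.
    by have [p Fp hp] := curve v Cv; exists p => _; exact: curve_vi.
  exists Q; exact: (solves_vi_sunny_nonexpansive JP FC hQ).
move=> Q sQ; have [p Fp hp] := curve u Cu.
have -> : Q u = p.
  apply: (solves_vi_unique JP _ (curve_vi _ _ Fp hp)).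
  exact: (sunny_nonexpansive_solves_vi JP C_convex FC sQ Cu).
exact: (halpern_cvg JP C_convex S_self T_nonexpansive alpha_01 Cu Cx0 x_rec
  alpha_cvg0 alpha_sum S_strong S_NST Fp hp).
Qed.
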